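(* (1) Let $d=5$ or $d=7$. Then for every $E\in\mathbb{Q}(\lambda_1,\ldots,\lambda_d)$, $$1+\sum_{n=1}^{\infty} Z_n(\mathbb{C}^d)\,q^n\;\neq\; M_{d-1}(-q)^E .$$ (2) Let $d=8$ or $d=12$. Then there are $(\mathbb{C}^* )^d$-equivariant line bundles $L$ on $\mathbb{C}^d$ such that for every choice of orientation $o(\mathcal{L})$ and every $E\in\mathbb{Q}(\lambda_1,\ldots,\lambda_d)/(\lambda_1+\cdots+\lambda_d)$, $$1+\sum_{n=1}^{\infty} Z_n(\mathbb{C}^d,L,o(\mathcal{L}))\,q^n\;\neq\; M_{d-2}(-q)^E .$$
   Context: An $n$-partition is a family $\pi=\{\pi_{i_1\ldots i_n}\}_{i_1,\ldots,i_n\geq 1}$ of non-negative integers with $\pi_{i_1\ldots i_n}\geq\pi_{j_1\ldots j_n}$ whenever $i_a\leq j_a$ for all $a$, and with finite size $|\pi|:=\sum\pi_{i_1\ldots i_n}<\infty$. Put $M_n(q):=\sum_{n\text{-partitions }\pi}q^{|\pi|}$. For a power series $F(q)$ with constant term $1$, $F^E:=\exp(E\log F)$. $(\mathbb{C}^* )^d$ acts on $\mathbb{C}^d$ in the standard way, the coordinate function $x_i$ having character $t_i$; $\lambda_i$ is the equivariant first Chern class of the character $t_i$. $T=\{t_1\cdots t_d=1\}\subset(\mathbb{C}^* )^d$ is the Calabi-Yau subtorus. $\mathrm{Hilb}^n(\mathbb{C}^d)$ is the Hilbert scheme of $n$ points. $\mathrm{Hilb}^n(\mathbb{C}^d)^T=\mathrm{Hilb}^n(\mathbb{C}^d)^{(\mathbb{C}^*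 )^d}$ consists of finitely many reduced points, namely the subschemes $Z$ of length $n$ cut out by monomial ideals; they correspond bijectively to $(d-1)$-partitions of size $n$. $I_Z$ is the ideal sheaf of $Z$ and $\mathrm{Ext}^i(I_Z,I_Z)_0$ is the trace-free part (kernel of the trace map $\mathrm{Ext}^i(I_Z,I_Z)\to H^i(\mathcal{O}_{\mathbb{C}^d})$). $\mathrm{Ext}^{\mathrm{even}}(I_Z,I_Z)_0$ (resp. $\mathrm{Ext}^{\mathrm{odd}}(I_Z,I_Z)_0$) is the sum of the $\mathrm{Ext}^{i}(I_Z,I_Z)_0$ over even (resp. odd) $i$ in equivariant $K$-theory of a point. For a virtual representation $\sum_w a_w t^w$ of a torus, the equivariant Euler class is $\prod_w (w_1\lambda_1+\cdots+w_d\lambda_d)^{a_w}$ (which is $0$ if the trivial character has positive coefficient and is only defined if this coefficient is non-negative). Quotients $e(\mathrm{Ext}^{\mathrm{even}})/e(\mathrm{Ext}^{\mathrm{odd}})$ mean the Euler class of the virtual difference. $\mathbb{Q}(\lambda_1,\ldots,\lambda_d)/(\lambda_1+\cdots+\lambda_d)$ denotes the fraction field of $\mathbb{Q}[\lambda_1,\ldots,\lambda_d]/(\lambda_1+\cdots+\lambda_d)$. For $d$ odd, $$Z_n(\mathbb{C}^d):=\sum_{[Z]\in\mathrm{Hilb}^n(\mathbb{C}^d)^{(\mathbb{C}^* )^d}}\frac{e_{(\mathbb{C}^* )^d}(\mathrm{Ext}^{\mathrm{even}}(I_Z,I_Z)_0)}{e_{(\mathbb{C}^* )^d}(\mathrm{Ext}^{\mathrm{odd}}(I_Z,I_Z)_0)}.$$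 For $d\equiv 0\bmod 4$ and a $T$-equivariant line bundle $L$, $$Z_n(\mathbb{C}^d,L,o(\mathcal{L})):=\sum_{[Z]\in\mathrm{Hilb}^n(\mathbb{C}^d)^T}(-1)^{o(\mathcal{L})|_Z}\sqrt{(-1)^n\frac{e_T(\mathrm{Ext}^{\mathrm{even}}(I_Z,I_Z)_0)}{e_T(\mathrm{Ext}^{\mathrm{odd}}(I_Z,I_Z)_0)}}\cdot e_T(L^{[n]}|_Z),$$ where the expression under the root is a square in $\mathbb{Q}(\lambda_1,\ldots,\lambda_d)/(\lambda_1+\cdots+\lambda_d)$, a choice of orientation $o(\mathcal{L})$ is a choice of sign of the square root for each $Z$, and $L^{[n]}$ is the tautological bundle with fibre $L^{[n]}|_Z=H^0(L|_Z)$. *)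

(* Defs.v *)
From HB Require Import structures.
From mathcomp Require Import all_boot all_order all_algebra finmap.
From mathcomp Require Import boolp classical_sets functions cardinality fsbigop.
From mathcomp Require Import reals complex.
From mathcomp Require Import mpoly.

Set Implicit Arguments.
Unset Strict Implicit.
Unset Printing Implicit Defensive.

Import Order.TTheory GRing.Theory Num.Theory.

Local Open Scope classical_set_scope.
Local Open Scope ring_scope.

(* A power series F over K is the sequence of its coefficients F n. *)

Section PowerSeries.
Variable K : fieldType.

Definition ps_trunc (n : nat) (F : nat -> K) : {poly K} := \poly_(i < n.+1) F i.

(* log F for F with constant term 1: the n-th coefficient only involves the
   powers (F - 1)^k with k <= n. *)
Definition ps_log (F : nat -> K) : nat -> K := fun n =>
  (\sum_(1 <= k < n.+1) ((-1) ^+ k.+1 / k%:R) *: (ps_trunc n F - 1) ^+ k)`_n.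

(* exp G for G with constant term 0. *)
Definition ps_exp (G : nat -> K) : nat -> K := fun n =>
  (\sum_(0 <= k < n.+1) (k`!%:R)^-1 *: ps_trunc n G ^+ k)`_n.

Definition ps_pow (F : nat -> K) (E : K) : nat -> K :=
  ps_exp (fun n => E * ps_log F n).

(* 1 + \sum_(n >= 1) a n q^n *)
Definition ps_one_plus (a : nat -> K) : nat -> K :=
  fun n => if n == 0%N then 1 else a n.

End PowerSeries.

(* The indices i_1, ..., i_n of an n-partition start at 0 instead of 1, so that
   they are the elements of 'X_{1..n} with its componentwise order. *)
Definition is_partition (n k : nat) (p : 'X_{1..n} -> nat) : Prop :=
  [/\ forall i j, (i <= j)%MM -> (p j <= p i)%N,
      finite_set [set i | p i <> 0%N]
    & \big[addn/0%N]_(i \in [set: 'X_{1..n}]) p i = k].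

Definition num_partitions (n k : nat) : nat :=
  #|` fset_set [set p : 'X_{1..n} -> nat | is_partition k p] |.

(* M_n(-q) *)
Definition macmahon_neg (K : fieldType) (n : nat) : nat -> K :=
  fun k => (-1) ^+ k * (num_partitions n k)%:R.

(* Characters t^w of (C^* )^d. *)
Notation weight d := {ffun 'I_d -> int}.

Definition exp_weight (d : nat) (u : 'X_{1..d}) : weight d :=
  [ffun i => (u i)%:Z].

(* The subscheme cut out by a monomial ideal I of finite colength is encoded by
   the finite set Z of the exponents u with x^u \notin I: the x^u, u \in Z, form
   a basis of O_Z. *)
Definition order_ideal (d : nat) (Z : {fset 'X_{1..d}}) : Prop :=
  forall u v, (u <= v)%MM -> v \in Z -> u \in Z.

Definition fixed_points (d n : nat) : set {fset 'X_{1..d}} :=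
  [set Z | order_ideal Z /\ #|` Z| = n].
Arguments fixed_points : clear implicits.

(* x^w, for w \in Z^d, is a monomial of the ideal I_Z. *)
Definition in_ideal (d : nat) (Z : {fset 'X_{1..d}}) (w : weight d) : bool :=
  [forall i, 0 <= w i] && ([multinom `|w i|%N | i < d] \notin Z).

Lemma in_ideal_le (d : nat) (Z : {fset 'X_{1..d}}) (w w' : weight d) :
  order_ideal Z -> (forall i, w i <= w' i) -> in_ideal Z w -> in_ideal Z w'.
Proof.
move=> ZP ww' /andP[/forallP w0 wZ]; apply/andP; split.
  by apply/forallP => i; apply: le_trans (ww' i).
apply: contra wZ; apply: ZP; apply/mnm_lepP => i; rewrite !mnmE -lez_nat.
by rewrite !gez0_abs // (le_trans (w0 i)).
Qed.

(* Minimal monomial generators of I_Z; every one of them is 1 or of the form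
   x_i x^u with u \in Z. *)
Definition mingens (d : nat) (Z : {fset 'X_{1..d}}) : seq 'X_{1..d} :=
  [seq v <- undup (0%MM :: [seq (u + U_(i))%MM | u <- Z, i <- enum 'I_d])
     | (v \notin Z) && [forall i, (0 < v i)%N ==> ((v - U_(i))%MM \in Z)]].

Lemma mingensP (d : nat) (Z : {fset 'X_{1..d}}) (v : 'X_{1..d}) :
  (v \in mingens Z) =
  (v \notin Z) && [forall i, (0 < v i)%N ==> ((v - U_(i))%MM \in Z)].
Proof.
rewrite mem_filter; apply: andb_idr => /andP[_ /forallP vP].
rewrite mem_undup inE; have [//|/= v0] := eqVneq v 0%MM.
have [i vi] : exists i, (0 < v i)%N.
  apply/existsP; apply: contraNT v0; rewrite negb_exists => /forallP v0.
  apply/eqP/mnmP => i; rewrite mnm0E; apply/eqP.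
  by have := v0 i; rewrite lt0n negbK.
apply/allpairsP; exists ((v - U_(i))%MM, i); split => /=.
- by have := vP i; rewrite vi.
- by rewrite mem_enum.
- by rewrite submK // lep1mP -lt0n.
Qed.

Lemma mingens_generate (d : nat) (Z : {fset 'X_{1..d}}) (v : 'X_{1..d}) :
  order_ideal Z -> (v \notin Z) = has (fun g => g <= v)%MM (mingens Z).
Proof.
move=> ZP; apply/idP/hasP => [|[g]]; last first.
  rewrite mingensP => /andP[gZ _] gv; apply: contra gZ; exact: ZP.
have [n] := ubnP (mdeg v); elim: n v => // n IH v; rewrite ltnS => vn vZ.
have [/forallP vP|] := boolP [forall i, (0 < v i)%N ==> ((v - U_(i))%MM \in Z)].
  by exists v; rewrite ?lepm_refl // mingensP vZ; apply/forallP.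
rewrite negb_forall => /existsP[j]; rewrite negb_imply => /andP[vj vjZ].
have jv : (U_(j) <= v)%MM by rewrite lep1mP -lt0n.
have [|//|g gZ gv] := IH (v - U_(j))%MM.
  have := congr1 (@mdeg d) (submK jv); rewrite mdegD mdeg1 => e.
  by rewrite -e addn1 in vn.
by exists g => //; apply: lepm_trans gv (lem_subr _ _).
Qed.

(* The Taylor resolution ... -> F_1 -> F_0 -> I_Z of the Z^d-graded module I_Z
   over k[x_1, ..., x_d]. The basis of F_i consists of the e_S, S a set of i + 1
   minimal generators, e_S having the degree of glcm S, and
     d e_S = \sum_(j in S) taylor_sign S j x^(glcm S - glcm (S :\ j)) e_(S :\ j).
   The augmentation F_0 -> I_Z maps e_[set j] to x^(mingen j); it is treated as
   the component F_0 -> F_(-1) = k[x_1, ..., x_d] e_set0 of the differential. *)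
Section Taylor.
Variables (k : fieldType) (d : nat) (Z : {fset 'X_{1..d}}).

Local Notation m := (size (mingens Z)).
Local Notation V := {ffun {set 'I_m} -> k^o}.

Definition mingen (j : 'I_m) : 'X_{1..d} := nth 0%MM (mingens Z) j.

Definition glcm (S : {set 'I_m}) : 'X_{1..d} :=
  \big[@mlcm d/0%MM]_(j in S) mingen j.

Definition taylor_sign (S : {set 'I_m}) (j : 'I_m) : k :=
  (-1) ^+ #|[set i in S | (i < j)%N]|.

(* f represents the element \sum_S f S x^(u - glcm S) e_S, of degree u, of
   F_(n - 1). *)
Definition taylor_chain (n : nat) (u : 'X_{1..d}) (f : V) : Prop :=
  forall S, f S != 0 -> #|S| = n /\ (glcm S <= u)%MM.

Definition taylor_diff (f : V) : V :=
  [ffun S : {set 'I_m} =>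
     \sum_(j | j \notin S) taylor_sign (j |: S) j * f (j |: S)].

Lemma sgnU1 (S : {set 'I_m}) (i j : 'I_m) : j \notin S ->
  taylor_sign (j |: S) i = (if (j < i)%N then -1 else 1) * taylor_sign S i.
Proof.
move=> jS; rewrite /taylor_sign.
have [ji|ji] := boolP (j < i)%N; last first.
  rewrite mul1r; congr (_ ^+ _); apply: eq_card => l; rewrite !inE.
  by case: eqVneq => // ->; rewrite (negPf jS) (negPf ji).
rewrite -exprS; congr (_ ^+ _); rewrite (cardsD1 j) !inE eqxx ji add1n.
congr _.+1; apply: eq_card => l; rewrite !inE.
by case: eqVneq => // ->; rewrite (negPf jS).
Qed.

Lemma sgn_swap (S : {set 'I_m}) (i j : 'I_m) :
    i \notin S -> j \notin S -> i != j ->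
  taylor_sign (i |: S) i * taylor_sign (j |: (i |: S)) j =
  - (taylor_sign (j |: S) j * taylor_sign (i |: (j |: S)) i).
Proof.
move=> iS jS ij.
have jiS : j \notin i |: S by rewrite !inE negb_or eq_sym ij.
have ijS : i \notin j |: S by rewrite !inE negb_or ij.
rewrite !sgnU1 // !ltnn !mul1r.
case: (ltngtP i j) => [_|_|/val_inj e]; last by rewrite e eqxx in ij.
  by rewrite mulN1r mul1r mulrN mulrC.
by rewrite mulN1r mul1r mulrN opprK mulrC.
Qed.

Lemma sum_antisym (P : pred 'I_m) (A : 'I_m -> 'I_m -> k) :
    (forall i j, P i -> P j -> i != j -> A i j = - A j i) ->
  \sum_(i | P i) \sum_(j | P j && (j != i)) A i j = 0.
Proof.
move=> AP.
rewrite (eq_bigr (fun i : 'I_m => \sum_(j | P j && (j < i)%N) A i j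
                        + \sum_(j | P j && (i < j)%N) A i j)); last first.
  move=> i _; rewrite (bigID (fun j : 'I_m => (j < i)%N)) /=.
  by congr (_ + _); apply: eq_bigl => j; rewrite -val_eqE /=;
    case: (P j) => //=; case: ltngtP.
rewrite big_split /= [X in _ + X](exchange_big_dep P) /=; last by move=> ? ? ? /andP[].
apply/eqP; rewrite addr_eq0 -sumrN; apply/eqP; apply: eq_bigr => i Pi.
rewrite -sumrN; apply: eq_big => [j|j /andP[Pj ji]]; first by rewrite ?Pi ?andbT.
by rewrite AP // -val_eqE /= gtn_eqF.
Qed.

Lemma taylor_diffK (f : V) : taylor_diff (taylor_diff f) = 0.
Proof.
apply/ffunP => S; rewrite !ffunE.
under eq_bigr => j jS do rewrite ffunE mulr_sumr.
rewrite -[RHS](@sum_antisym [pred j | j \notin S]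
  (fun j l => taylor_sign (j |: S) j * (taylor_sign (l |: (j |: S)) l * f (l |: (j |: S))))).
  apply: eq_bigr => j jS; apply: eq_bigl => l.
  by rewrite !inE negb_or andbC.
move=> i j /= iS jS ij; rewrite !mulrA sgn_swap // mulNr.
by rewrite (finset.setUCA [set j]).
Qed.

Lemma glcm_le (S : {set 'I_m}) (u : 'X_{1..d}) :
  (glcm S <= u)%MM = [forall j in S, (mingen j <= u)%MM].
Proof.
rewrite /glcm -big_andE; apply: (big_ind2 (fun v b => (v <= u)%MM = b)) => //.
  by apply/mnm_lepP => i; rewrite mnm0E.
by move=> v b v' b' <- <-; rewrite lem_mlcm.
Qed.

(* The augmented complex is exact in every degree u with x^u \in I_Z, and only
   F_(-1) is nonzero in the other degrees: F is a resolution of I_Z. *)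
Lemma taylor_exact (n : nat) (u : 'X_{1..d}) (f : V) : order_ideal Z ->
    u \notin Z -> taylor_chain n u f -> taylor_diff f = 0 ->
  exists2 g, taylor_chain n.+1 u g & taylor_diff g = f.
Proof.
move=> ZP uZ fu df.
have [a0 a0u] : exists a : 'I_m, (mingen a <= u)%MM.
  move: uZ; rewrite mingens_generate // => /(has_nthP 0%MM)[i im iu].
  by exists (Ordinal im).
pose a := [arg min_(i < a0 | (mingen i <= u)%MM) (i : nat)].
have [au amin] : (mingen a <= u)%MM /\ forall i : 'I_m, (mingen i <= u)%MM -> (a <= i)%N.
  by rewrite /a; case: arg_minnP.
have fa (S : {set 'I_m}) i : f S != 0 -> i \in S -> (a <= i)%N.
  by move=> /fu[_]; rewrite glcm_le => /forall_inP Su /Su; apply: amin.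
have sgn0 (S : {set 'I_m}) T : f T != 0 -> S \subset T -> taylor_sign S a = 1.
  move=> fT ST; rewrite /taylor_sign eq_card0 // => i; rewrite !inE.
  by apply/negP => /andP[/(fintype.subsetP ST) /(fa _ _ fT)]; rewrite leqNgt => /negPf ->.
exists [ffun S : {set 'I_m} => if a \in S then f (S :\ a) else 0].
  move=> S; rewrite ffunE; case: ifP => [aS fS|]; last by rewrite eqxx.
  have [<- lu] := fu _ fS; rewrite (cardsD1 a) aS; split => //.
  rewrite glcm_le; apply/forall_inP => i iS.
  have [->//|ia] := eqVneq i a; move: lu; rewrite glcm_le => /forall_inP; apply.
  by rewrite !inE ia.
apply/ffunP => S; rewrite ffunE; have [aS|aS] := boolP (a \in S); last first.
  rewrite (bigD1 a) //= ffunE finset.setU11 finset.setU1K // big1 ?addr0; last first.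
    by move=> j /andP[_ ja]; rewrite ffunE !inE eq_sym (negPf ja) (negPf aS) mulr0.
  rewrite sgnU1 // ltnn mul1r.
  have [->|fS] := eqVneq (f S) 0; first by rewrite mulr0.
  by rewrite (sgn0 S S) // mul1r.
have /ffunP/(_ (S :\ a)) := df; rewrite !ffunE (bigD1 a) ?finset.setD11 //=.
rewrite finset.setD1K // => /eqP; rewrite addr_eq0 => /eqP e.
transitivity (taylor_sign S a * f S); last first.
  have [->|fS] := eqVneq (f S) 0; first by rewrite mulr0.
  by rewrite (sgn0 S S) // mul1r.
rewrite e -sumrN; apply: eq_big => [j|j jS].
  rewrite !inE; case: eqVneq => [->|]; rewrite ?aS ?andbF ?andbT //=.
have ja : a != j by apply: contraNneq jS => <-.
rewrite ffunE !inE aS orbT.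
have -> : (j |: S) :\ a = j |: (S :\ a).
  by apply/finset.setP => i; rewrite !inE; case: (eqVneq i j) => // ->; rewrite eq_sym ja.
have [->|fS] := eqVneq (f (j |: (S :\ a))) 0; first by rewrite !mulr0 oppr0.
have aj : (a < j)%N by rewrite ltn_neqAle val_eqE ja (fa _ _ fS) // finset.setU11.
rewrite -mulNr; congr (_ * _).
have jSa : j \notin S :\ a by rewrite !inE negb_and jS orbT.
rewrite -[in LHS](finset.setD1K aS) finset.setUCA (@sgnU1 _ _ a) ?aj ?mulN1r //.
by rewrite !inE eqxx orbF.
Qed.

(* The pullback f \o d of f : F_i -> I_Z; see ext_cochains for the encoding. *)
Definition taylor_codiff (f : V) : V :=
  [ffun S : {set 'I_m} => \sum_(j in S) taylor_sign S j * f (S :\ j)].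

Lemma taylor_codiff_is_linear : linear taylor_codiff.
Proof.
move=> c f g; apply/ffunP => S; rewrite !ffunE scaler_sumr -big_split.
by apply: eq_bigr => j _; rewrite !ffunE mulrDr; congr (_ + _); exact: mulrCA.
Qed.
HB.instance Definition _ :=
  GRing.isLinear.Build k V V _ taylor_codiff taylor_codiff_is_linear.

Lemma taylor_codiffK (f : V) : taylor_codiff (taylor_codiff f) = 0.
Proof.
apply/ffunP => S; rewrite !ffunE.
under eq_bigr => j jS do rewrite ffunE mulr_sumr.
rewrite -[RHS](@sum_antisym [pred j | j \in S]
  (fun j l => taylor_sign S j * (taylor_sign (S :\ j) l * f ((S :\ j) :\ l)))).
  by apply: eq_bigr => j jS; apply: eq_bigl => l; rewrite !inE andbC.
move=> i j /= iS jS ij; rewrite !mulrA.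
have ji : j != i by rewrite eq_sym.
pose T := S :\ i :\ j.
have e1 : S :\ i = j |: T by rewrite finset.setD1K // !inE ji.
have e2 : S :\ j = i |: T.
  apply/finset.setP => l; rewrite /T !inE.
  by case: (eqVneq l i) => [->|]; rewrite ?ij.
have e3 : S :\ j :\ i = T by apply/finset.setP => l; rewrite /T !inE andbCA.
have e4 : S = i |: (j |: T) by rewrite -e1 finset.setD1K.
have e5 : S = j |: (i |: T) by rewrite -e2 finset.setD1K.
rewrite e3 -/T e1 e2 [in LHS]e4 [in RHS]e5 -mulNr; congr (_ * _).
rewrite mulrC [X in - X]mulrC; apply: sgn_swap => //; rewrite /T !inE ?eqxx ?andbF //.
Qed.

(* The homomorphisms F_i -> I_Z of degree w: f : V represents
   e_S |-> f S x^(w + glcm S), which requires x^(w + glcm S) \in I_Z. *)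
Definition ext_cochains (i : nat) (w : weight d) : {vspace V} :=
  (\sum_(S : {set 'I_m} |
         (#|S| == i.+1) && in_ideal Z (w + exp_weight (glcm S))%R)
     <[ [ffun S' => (S' == S)%:R] : V ]>)%VS.

Lemma ext_cochainsP (i : nat) (w : weight d) (f : V) :
  reflect
    (forall S, f S != 0 -> #|S| = i.+1 /\ in_ideal Z (w + exp_weight (glcm S)))
    (f \in ext_cochains i w).
Proof.
apply: (iffP memv_sumP) => [[h hS ->] S|fP].
  apply: contraNP => SP; rewrite sum_ffunE big1 // => T TP.
  have /vlineP[c ->] := hS T TP; rewrite !ffunE.
  case: eqVneq => [e|]; last by rewrite scaler0.
  by case: SP; rewrite e; case/andP: TP => /eqP.
exists (fun S => [ffun S' => f S * (S' == S)%:R]) => [S _|].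
  by apply/vlineP; exists (f S); apply/ffunP => S'; rewrite !ffunE.
apply/ffunP => S; rewrite sum_ffunE.
have [f0|/fP[/eqP S1 S2]] := eqVneq (f S) 0.
  rewrite big1 ?f0 // => T _; rewrite ffunE.
  by case: eqVneq => [<-|]; rewrite ?f0 ?mul0r ?mulr0.
rewrite (bigD1 S) ?S1 //= ffunE eqxx mulr1 big1 ?addr0 // => T /andP[_ TS].
by rewrite ffunE eq_sym (negPf TS) mulr0.
Qed.

Definition ext_cocycles (i : nat) (w : weight d) : {vspace V} :=
  (ext_cochains i w :&: lker (linfun taylor_codiff))%VS.

Definition ext_coboundaries (i : nat) (w : weight d) : {vspace V} :=
  if i is i'.+1 then (linfun taylor_codiff @: ext_cochains i' w)%VS else 0%VS.

(* The trace Ext^i(I_Z, I_Z) -> H^i(O). For i > 0 the target is 0. A homomorphism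
   I_Z -> I_Z of degree w is multiplication by c x^w, where c is the value of the
   cocycle at any generator (ext_trace_gen), and its trace is c x^w. *)
Definition ext_trace (i : nat) (f : V) : k^o :=
  if i is 0%N then if [pick j : 'I_m] is Some j then f [set j]%SET else 0
  else 0.

Lemma ext_trace_is_linear (i : nat) : linear (ext_trace i).
Proof.
case: i => [|i] c f g /=; last by rewrite scaler0 addr0.
by case: pickP => [j _|_]; rewrite ?ffunE // scaler0 addr0.
Qed.
HB.instance Definition _ (i : nat) :=
  GRing.isLinear.Build k V k^o _ (ext_trace i) (ext_trace_is_linear i).

Lemma ext_trace_gen (w : weight d) (f : V) (j : 'I_m) :
  f \in ext_cocycles 0 w -> f [set j]%SET = ext_trace 0 f.
Proof.
rewrite memv_cap memv_ker lfunE /= => /andP[_ /eqP/ffunP df].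
case: pickP => [i _|/(_ j)//]; have [->//|ji] := eqVneq j i.
wlog lt_ij : i j ji / (i < j)%N => [H|].
  have [ij|ij] := ltnP i j; first exact: H.
  by apply/esym/H; rewrite 1?eq_sym // ltn_neqAle ij eq_sym val_eqE eq_sym ji.
have := df [set i; j]%SET; rewrite !ffunE (bigD1 i) ?set21 //= (bigD1 j) /=; last first.
  by rewrite set22.
rewrite big1 ?addr0; last first.
  by move=> l; rewrite !inE; case: eqVneq => //= _; case: eqVneq.
have -> : [set i; j]%SET :\ i = [set j]%SET.
  by apply/finset.setP => l; rewrite !inE; case: (eqVneq l i) => // ->; rewrite eq_sym (negPf ji).
have -> : [set i; j]%SET :\ j = [set i]%SET.
  by apply/finset.setP => l; rewrite !inE; case: (eqVneq l j) => [->|_]; rewrite ?(negPf ji) ?orbF.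
have -> : taylor_sign [set i; j]%SET i = 1.
  rewrite /taylor_sign eq_card0 // => l; rewrite !inE.
  by case: (eqVneq l i) => [->|_]; rewrite ?ltnn ?andbF //=;
    case: eqVneq => // ->; rewrite ltnNge ltnW.
have -> : taylor_sign [set i; j]%SET j = -1.
  rewrite /taylor_sign -[RHS]expr1 -(cards1 i); congr (_ ^+ _); apply: eq_card => l.
  rewrite !inE; by case: (eqVneq l i) => [->|_]; rewrite ?lt_ij //=;
    case: eqVneq => // ->; rewrite ltnn.
by rewrite mul1r mulN1r => /eqP; rewrite subr_eq0 => /eqP.
Qed.

Lemma ext_coboundaries_sub (i : nat) (w : weight d) : order_ideal Z ->
  (ext_coboundaries i w <= ext_cocycles i w :&: lker (linfun (ext_trace i)))%VS.
Proof.
move=> ZP; case: i => [|i]; first exact: sub0v.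
apply/subvP => _ /memv_imgP[f /ext_cochainsP fP ->].
rewrite !memv_cap !memv_ker !lfunE /= taylor_codiffK !eqxx !andbT.
apply/ext_cochainsP => S; rewrite ffunE => S0.
have [j jS /fP[S1 S2]] : exists2 j, j \in S & f (S :\ j) != 0.
  apply/exists_inP; apply: contraNT S0; rewrite negb_exists_in => /forall_inP S0.
  rewrite big1 // => j /S0; rewrite negbK => /eqP ->; exact: mulr0.
rewrite (cardsD1 j) jS S1; split => //.
apply: (in_ideal_le ZP) S2 => l; rewrite !ffunE lerD2l lez_nat.
apply/mnm_lepP; rewrite glcm_le; apply/forall_inP => a /setD1P[_].
by move: a; apply/forall_inP; rewrite -glcm_le lepm_refl.
Qed.

(* Dimension of the weight w subspace of Ext^i(I_Z, I_Z)_0. *)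
Definition ext0_dim (i : nat) (w : weight d) : nat :=
  (\dim (ext_cocycles i w :&: lker (linfun (ext_trace i)))
   - \dim (ext_coboundaries i w))%N.

(* Ext^even(I_Z, I_Z)_0 - Ext^odd(I_Z, I_Z)_0; note that F_i = 0 for i >= m. *)
Definition ext0_char (w : weight d) : int :=
  \sum_(i < m) (-1) ^+ i * (ext0_dim i w)%:Z.

End Taylor.

(* e(V) for a virtual representation V with multiplicities a, where A is the set
   of characters and lam i the first Chern class of t_i. If the trivial character
   has negative multiplicity, e(V) is undefined and the value here is irrelevant
   (it is 0). *)
Definition chern1 (d : nat) (F : fieldType) (lam : 'I_d -> F)
    (w : weight d) : F :=
  \sum_i lam i *~ w i.

Definition euler (d : nat) (F : fieldType) (lam : 'I_d -> F)
    (A : set (weight d)) (a : weight d -> int) : F :=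
  \big[*%R/1]_(w \in A) chern1 lam w ^ a w.

(* Q(lambda_1, ..., lambda_d) *)
Definition lam_field (d : nat) : fieldType := {fraction {mpoly rat[d]}}.

Definition lam (d : nat) (i : 'I_d) : lam_field d :=
  FracField.tofrac ('X_i : {mpoly rat[d]}).

(* The ideal (lambda_1 + ... + lambda_d) of Q[lambda_1, ..., lambda_d]. *)
Definition lam_sum (d : nat) : {mpoly rat[d]} := \sum_(i < d) 'X_i.

Definition cy_ideal (d : nat) : {pred {mpoly rat[d]}} :=
  fun p => `[< exists q, p = q * lam_sum d >].
Arguments cy_ideal : clear implicits.

(* lambda_d |-> - lambda_1 - ... - lambda_(d - 1) *)
Definition cy_subst (n : nat) : n.+1.-tuple {mpoly rat[n.+1]} :=
  [tuple if i == ord_max then - \sum_(j < n.+1 | j != ord_max) 'X_j else 'X_i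
     | i < n.+1].

Lemma cy_idealE (n : nat) (p : {mpoly rat[n.+1]}) :
  cy_ideal n.+1 p = (p \mPo cy_subst n == 0).
Proof.
have s0 : lam_sum n.+1 \mPo cy_subst n = 0.
  rewrite /lam_sum raddf_sum (bigD1 ord_max) //= comp_mpolyXU -tnth_nth tnth_mktuple.
  rewrite eqxx addrC; apply/eqP; rewrite subr_eq0; apply/eqP/eq_bigr => i ni.
  by rewrite comp_mpolyXU -tnth_nth tnth_mktuple (negPf ni).
pose cong (a b : {mpoly rat[n.+1]}) := exists q, a - b = q * lam_sum n.+1.
have congM a b a' b' : cong a b -> cong a' b' -> cong (a * a') (b * b').
  move=> [q e] [q' e']; exists (q * a' + b * q').
  by rewrite mulrDl [q * a' * _]mulrAC -e -mulrA -e' mulrBl mulrBr addrA subrK.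
have congX : cong p (p \mPo cy_subst n).
  elim/mpolyind: p => [|c m p _ _ [q e]].
    by exists 0; rewrite comp_mpoly0 subrr mul0r.
  have [q' e'] : cong 'X_[m] ('X_[m] \mPo cy_subst n).
    rewrite comp_mpolyX mpolyXE_id; elim/big_ind2: _ => [|? ? ? ? H H'|i _].
    - by exists 0; rewrite subrr mul0r.
    - exact: congM H H'.
    elim: (m i) => [|r IH]; first by exists 0; rewrite !expr0 subrr mul0r.
    rewrite !exprS; apply: congM IH; rewrite tnth_mktuple.
    have [->|_] := eqVneq i ord_max; last by exists 0; rewrite subrr mul0r.
    by exists 1; rewrite mul1r opprK /lam_sum [RHS](bigD1 ord_max).
  exists (c *: q' + q).
  by rewrite linearP /= mulrDl -e -scalerAl -e' scalerBr opprD addrACA.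
apply/asboolP/eqP => [[q ->]|p0]; first by rewrite rmorphM /= s0 mulr0.
by have [q] := congX; rewrite p0 subr0; exists q.
Qed.

Lemma cy_ideal_idealr (d : nat) : idealr_closed (cy_ideal d).
Proof.
split.
- by apply/asboolP; exists 0; rewrite mul0r.
- case: d => [|n]; last by rewrite -topredE /= cy_idealE rmorph1 oner_neq0.
  by apply/asboolP => -[q /eqP]; rewrite /lam_sum big_ord0 mulr0 oner_eq0.
- move=> a u v /asboolP[q ->] /asboolP[r ->]; apply/asboolP.
  by exists (a * q + r); rewrite mulrDl mulrA.
Qed.

Lemma cy_ideal_prime (d : nat) : prime_idealr_closed (cy_ideal d).
Proof.
case: d => [|n] u v; last first.
  by rewrite -!topredE /= !cy_idealE rmorphM /= mulf_eq0.
have E (p : {mpoly rat[0]}) : cy_ideal 0 p = (p == 0).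
  apply/asboolP/eqP => [[q ->]|->]; first by rewrite /lam_sum big_ord0 mulr0.
  by exists 0; rewrite mul0r.
by rewrite -!topredE /= !E mulf_eq0.
Qed.

HB.instance Definition _ (d : nat) :=
  isIdealr.Build {mpoly rat[d]} (cy_ideal d) (cy_ideal_idealr d).
HB.instance Definition _ (d : nat) :=
  isPrimeIdealrClosed.Build {mpoly rat[d]} (cy_ideal d) (@cy_ideal_prime d).

(* Q[lambda_1, ..., lambda_d] / (lambda_1 + ... + lambda_d) *)
Definition cy_ring (d : nat) : Type := {ideal_quot (cy_ideal d)}.
HB.instance Definition _ (d : nat) := GRing.ComNzRing.on (cy_ring d).

Section CyUnits.
Variable d : nat.

Definition cy_unit : {pred cy_ring d} := fun x => `[< exists y, y * x = 1 >].
Definition cy_inv (x : cy_ring d) : cy_ring d := xget x [set y | y * x = 1].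

Lemma cy_mulVx : {in cy_unit, left_inverse 1 cy_inv *%R}.
Proof. by move=> x /asboolP[y yx]; rewrite /cy_inv; case: xgetP => // /(_ y). Qed.

Lemma cy_unitPl (x y : cy_ring d) : y * x = 1 -> x \in cy_unit.
Proof. by move=> yx; apply/asboolP; exists y. Qed.

Lemma cy_invr_out : {in [predC cy_unit], cy_inv =1 id}.
Proof.
move=> x /asboolPn nx; rewrite /cy_inv; case: xgetP => // y _ yx.
by case: nx; exists y.
Qed.

HB.instance Definition _ :=
  GRing.ComNzRing_hasMulInverse.Build (cy_ring d) cy_mulVx cy_unitPl cy_invr_out.
HB.instance Definition _ :=
  GRing.ComUnitRing_isIntegral.Build (cy_ring d)
    (@Quotient.rquot_IdomainAxiom _ (cy_ideal d)).

End CyUnits.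

Definition cy_field (d : nat) : fieldType := {fraction (cy_ring d)}.

Definition cy_lam (d : nat) (i : 'I_d) : cy_field d :=
  FracField.tofrac (\pi_(cy_ring d)%qT ('X_i : {mpoly rat[d]}) : cy_ring d).

(* The characters of T = {t_1 ... t_d = 1} are the elements of Z^d modulo
   (1, ..., 1); they are represented by the w \in Z^d with first entry 0. *)
Definition cy_weights (d : nat) : set (weight d) :=
  [set w | forall i : 'I_d, i = 0%N :> nat -> w i = 0].
Arguments cy_weights : clear implicits.

(* Multiplicities of the restriction of a representation of (C^* )^d to T. *)
Definition cy_restrict (d : nat) (a : weight d -> int) : weight d -> int :=
  fun w => \sum_(c \in [set: int]) a [ffun i => w i + c].

Definition cy_euler (d : nat) (a : weight d -> int) : cy_field d :=
  euler (@cy_lam d) (cy_weights d) (cy_restrict a).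

(* A square root of x if there is one, and 0 otherwise. *)
Definition some_sqrt (F : fieldType) (x : F) : F := xget 0 [set y | y ^+ 2 = x].

(* Multiplicities of L^[n]|_Z = H^0(L|_Z) for the equivariant line bundle
   L = O (x) t^l; every equivariant line bundle on C^d is of this form. *)
Definition taut_char (d : nat) (l : weight d) (Z : {fset 'X_{1..d}}) :
    weight d -> int :=
  fun w => (count (fun u => l + exp_weight u == w) Z)%:Z.

(* Z_n(C^d) for d odd; Ext is computed over C = R[i]. *)
Definition Z_odd (R : realType) (d n : nat) : lam_field d :=
  \sum_(Z \in fixed_points d n) euler (@lam d) setT (ext0_char R[i] Z).

(* A choice of the sign (-1)^(o Z) for every fixed point Z. *)
Definition orientation (d : nat) : Type := {fset 'X_{1..d}} -> bool.

(* Z_n(C^d, L, o) for d divisible by 4, with L = O (x) t^l. *)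
Definition Z_cy (R : realType) (d : nat) (l : weight d)
    (o : orientation d) (n : nat) : cy_field d :=
  \sum_(Z \in fixed_points d n)
    (-1) ^+ o Z * some_sqrt ((-1) ^+ n * cy_euler (ext0_char R[i] Z))
    * cy_euler (taut_char l Z).

(* Main.v *)
Require Import Defs.
From mathcomp Require Import all_boot all_order all_algebra finmap.
From mathcomp Require Import boolp classical_sets functions cardinality fsbigop.
From mathcomp Require Import reals.
From mathcomp Require Import mpoly.
From mathcomp Require Import zify ring.

Set Implicit Arguments.
Unset Strict Implicit.
Unset Printing Implicit Defensive.

Import Order.TTheory GRing.Theory Num.Theory.

Local Open Scope ring_scope.

(** Both parts compare poles along the hyperplane H on which the sum
    l = lambda_0 + lambda_1 + lambda_2 vanishes. Suppose that a series
    1 + Z_1 q + Z_2 q^2 + ... is F^E, where F has rational coefficients. Its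
    logarithm is E times a rational series, so
      Z_1 = c_1 E  and  Z_2 = c_2 E + Z_1^2 / 2
    with c_1, c_2 rational. If Z_1 has a simple pole along H, then c_1 is not 0,
    and E has a simple pole too. Hence Z_2 has a double pole along H, coming from
    Z_1^2. But Z_2 has at most a simple pole, which is the contradiction
    ([simple_pole_not_power]).

    The fixed points with n = 1, 2 are the origin and the d subschemes {0, e_a};
    both are boxes prod_i {0, ..., n_i - 1}, that is, complete intersections. With Q
    the character of O_Z, the virtual representation Ext^even - Ext^odd is
      Q Q^dual prod_i (1 - 1/t_i) - Q - (-1)^d Q^dual / (t_1 ... t_d),
    and the i-th factor of the first term is the sum of the t_i^x with 0 <= x < n_i
    minus the sum of those with - n_i <= x < 0. The other two terms remove the weights
    without and with only negative entries. What is left are the weights w with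
    entries of both signs and - n_i <= w_i < n_i for all i, with multiplicity (-1)^k
    for k negative entries ([ext0_char_box], [box_char_support]). A weight vanishes on
    H if and only if it is a multiple of (1, 1, 1, 0, ..., 0). As n_i = 1 for some
    i < 3, the only such weight that occurs is the opposite of that vector, with
    multiplicity -1: the Euler class at each of these fixed points has a simple pole
    along H ([euler_box_pole]). So l Z_1 is a unit along H and l Z_2 is regular.

    For the Calabi-Yau torus and d even, Serre duality w <-> (-1, ..., -1) - w
    preserves the multiplicities and changes the sign of the Chern class, so the
    product over the weights with w_s >= 0, for a fixed s > 2, is a square root of
    the Euler class up to a sign, which is checked to be (-1)^n ([box_euler_square]).
    Half of the weights being left, the weights vanishing on H, now the combinations
    of (1, 1, 1, 0, ..., 0) and (0, 0, 0, 1, ..., 1), again contribute one simple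
    pole, for any choice of signs ([sqrt_cy_euler_box_pole]). The tautological classes
    have no poles, and for the line bundle of weight (0, 1, 0, ..., 0) the one at the
    origin does not vanish on H. *)

(** * The first two coefficients of a power of a series *)

Lemma ps_log0 (K : fieldType) (F : nat -> K) : ps_log F 0 = 0.
Proof. by rewrite /ps_log big_nil coef0. Qed.

Lemma ps_exp1 (K : fieldType) (G : nat -> K) : G 0%N = 0 -> ps_exp G 1 = G 1%N.
Proof.
move=> G0; rewrite /ps_exp !big_nat_recr //= big_nil add0r expr0 expr1.
by rewrite coefD !coefZ coef1 coef_poly /= mulr0 add0r invr1 mul1r.
Qed.

Lemma ps_exp2 (K : fieldType) (G : nat -> K) :
  G 0%N = 0 -> ps_exp G 2 = G 2%N + 2%:R^-1 * G 1%N ^+ 2.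
Proof.
move=> G0; rewrite /ps_exp !big_nat_recr //= big_nil add0r expr0 expr1 expr2.
rewrite !coefD !coefZ coef1 coefM !big_ord_recl big_ord0 /= !coef_poly /= G0.
by rewrite !(mul0r, mulr0, add0r, addr0) invr1 mul1r expr2.
Qed.

Lemma ps_pow1 (K : fieldType) (F : nat -> K) (E : K) :
  ps_pow F E 1 = E * ps_log F 1.
Proof. by rewrite /ps_pow ps_exp1 // ps_log0 mulr0. Qed.

Lemma ps_pow2 (K : fieldType) (F : nat -> K) (E : K) :
  ps_pow F E 2 = E * ps_log F 2 + 2%:R^-1 * (E * ps_log F 1) ^+ 2.
Proof. by rewrite /ps_pow ps_exp2 // ps_log0 mulr0. Qed.

(** In particular, the logarithm of a rational series is rational. *)
Lemma ps_log_map (K K' : fieldType) (f : {rmorphism K -> K'}) (F : nat -> K) n :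
  ps_log (f \o F) n = f (ps_log F n).
Proof.
have tr : ps_trunc n (f \o F) = map_poly f (ps_trunc n F).
  apply/polyP => i; rewrite coef_map !coef_poly; case: ifP => // _.
  by rewrite raddf0.
rewrite /ps_log -coef_map rmorph_sum; congr ((_ : {poly K'})`_n); apply: eq_bigr => k _.
rewrite /= map_polyZ rmorphXn rmorphB rmorph1 tr fmorph_div rmorphXn rmorphN1.
by rewrite rmorph_nat.
Qed.

Lemma macmahon_neg_map (K K' : fieldType) (f : {rmorphism K -> K'}) n :
  macmahon_neg K' n = f \o macmahon_neg K n.
Proof.
by apply/funext => k; rewrite /macmahon_neg /= rmorphM rmorphXn rmorphN1 rmorph_nat.
Qed.


(** * Fractions that are regular along a hyperplane *)

Section Place.
Variables (A : comNzRingType) (C : idomainType) (K : fieldType).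
Variables (rho : {rmorphism A -> K}) (phi : {rmorphism A -> C}).
Hypothesis rho_phi : forall f, rho f = 0 -> phi f = 0.

(** Here A is a ring of functions, rho maps it to the field K, possibly with a kernel,
    and phi is the restriction to a subvariety. The fractions whose denominator does
    not vanish on the subvariety form a local ring, which is described by its
    elements, its maximal ideal and its units. *)
Definition regular (x : K) : Prop :=
  exists f g, phi g != 0 /\ x = rho f / rho g.

Definition vanishing (x : K) : Prop :=
  exists f g, [/\ phi f = 0, phi g != 0 & x = rho f / rho g].

Definition invertible (x : K) : Prop :=
  exists f g, [/\ phi f != 0, phi g != 0 & x = rho f / rho g].

Lemma rho_neq0 (f : A) : phi f != 0 -> rho f != 0.
Proof. by apply: contraNneq => /rho_phi ->. Qed.

Lemma invertible_regular (x : K) : invertible x -> regular x.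
Proof. by move=> [f [g [_ g0 ->]]]; exists f, g. Qed.

Lemma regular_rho (f : A) : regular (rho f).
Proof. by exists f, 1; rewrite !rmorph1 oner_neq0 divr1. Qed.

Lemma vanishing_rho (f : A) : phi f = 0 -> vanishing (rho f).
Proof. by move=> f0; exists f, 1; rewrite !rmorph1 oner_neq0 divr1. Qed.

Lemma invertible_rho (f : A) : phi f != 0 -> invertible (rho f).
Proof. by move=> f0; exists f, 1; rewrite !rmorph1 oner_neq0 divr1. Qed.

Lemma regularD (x y : K) : regular x -> regular y -> regular (x + y).
Proof.
move=> [f [g [g0 ->]]] [f' [g' [g'0 ->]]].
exists (f * g' + f' * g), (g * g'); rewrite rmorphM mulf_neq0 //; split => //.
by rewrite addf_div ?rho_neq0 // !rmorphD !rmorphM.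
Qed.

Lemma regularM (x y : K) : regular x -> regular y -> regular (x * y).
Proof.
move=> [f [g [g0 ->]]] [f' [g' [g'0 ->]]].
exists (f * f'), (g * g'); rewrite rmorphM mulf_neq0 //; split => //.
by rewrite mulf_div !rmorphM.
Qed.

Lemma regularN (x : K) : regular x -> regular (- x).
Proof.
by move=> [f [g [g0 ->]]]; exists (- f), g; rewrite rmorphN mulNr.
Qed.

Lemma vanishingM (x y : K) : vanishing x -> regular y -> vanishing (x * y).
Proof.
move=> [f [g [f0 g0 ->]]] [f' [g' [g'0 ->]]].
exists (f * f'), (g * g'); rewrite !rmorphM f0 mul0r mulf_neq0 //; split => //.
by rewrite mulf_div.
Qed.

Lemma invertible1 : invertible 1.
Proof. by rewrite -(rmorph1 rho); apply: invertible_rho; rewrite rmorph1 oner_neq0. Qed.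

Lemma invertibleM (x y : K) : invertible x -> invertible y -> invertible (x * y).
Proof.
move=> [f [g [f0 g0 ->]]] [f' [g' [f'0 g'0 ->]]].
exists (f * f'), (g * g'); rewrite !rmorphM !mulf_neq0 //; split => //.
by rewrite mulf_div.
Qed.

Lemma invertibleN (x : K) : invertible x -> invertible (- x).
Proof.
by move=> [f [g [f0 g0 ->]]]; exists (- f), g; rewrite !rmorphN oppr_eq0 mulNr.
Qed.

Lemma invertibleV (x : K) : invertible x -> invertible x^-1.
Proof. by move=> [f [g [f0 g0 ->]]]; exists g, f; rewrite invf_div. Qed.

Lemma invertibleXz (x : K) (k : int) : invertible x -> invertible (x ^ k).
Proof.
move=> x1; have xn n : invertible (x ^+ n).
  by elim: n => [|n IH]; [exact: invertible1 | rewrite exprS; apply: invertibleM].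
by case: k => n; [apply: xn | apply: (invertibleV (xn n.+1))].
Qed.

Lemma invertible_neq0 (x : K) : invertible x -> x != 0.
Proof. by move=> [f [g [f0 g0 ->]]]; rewrite mulf_neq0 ?invr_eq0 ?rho_neq0. Qed.

(** Restricting the numerator and the denominator of a fraction is compatible with
    the equality of fractions, since rho f = 0 implies phi f = 0. *)
Lemma invertible_not_vanishing (x : K) : invertible x -> vanishing x -> False.
Proof.
move=> [f [g [f0 g0 ->]]] [f' [g' [f'0 g'0 /eqP]]].
rewrite eqr_div ?rho_neq0 // -!rmorphM -subr_eq0 -rmorphB => /eqP/rho_phi/eqP.
by rewrite rmorphB !rmorphM f'0 mul0r subr0 mulf_eq0 (negPf f0) (negPf g'0).
Qed.

(** In F^E with F rational, the first coefficient is a rational multiple of E, so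
    the second one is half the square of the first plus a rational multiple of the
    first. The square of a simple pole is a double pole, which nothing cancels: after
    multiplication by l^2, the square is a unit and the other terms vanish. *)
Lemma simple_pole_not_power (iota : {rmorphism rat -> A}) (n : nat) (a : nat -> K)
    (l E : K) :
    vanishing l -> invertible (l * a 1%N) -> regular (l * a 2%N) ->
  ps_one_plus a <> ps_pow (macmahon_neg K n) E.
Proof.
move=> l0 a1 a2 e.
have e1 := congr1 (fun F => F 1%N) e; have e2 := congr1 (fun F => F 2%N) e.
move: e1 e2; rewrite /ps_one_plus /= ps_pow1 ps_pow2.
rewrite (macmahon_neg_map (rho \o iota : {rmorphism _ -> _})) !ps_log_map /=.
set c1 := ps_log _ 1; set c2 := ps_log _ 2 => e1 e2.
have c1_neq0 : c1 != 0.
  apply: contraTneq (invertible_neq0 a1) => c0.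
  by rewrite e1 c0 !raddf0 !mulr0 eqxx.
have inv_iota c : c != 0 -> invertible (rho (iota c)).
  move=> c0; apply: invertible_rho.
  by rewrite -[phi _]/((phi \o iota : {rmorphism _ -> _}) c) fmorph_eq0.
have rc1 : rho (iota c1) != 0 by apply/invertible_neq0/inv_iota.
have r2 : (2 : K) != 0.
  by rewrite -(rmorph_nat (rho \o iota : {rmorphism _ -> _})) fmorph_eq0.
have eE : E = a 1%N / rho (iota c1) by rewrite e1 mulfK.
apply: (invertible_not_vanishing (invertibleM a1 a1)).
have -> : l * a 1%N * (l * a 1%N) =
    l * (rho (iota 2) * (l * a 2%N - l * a 1%N * (rho (iota c2) / rho (iota c1)))).
  rewrite !rmorph_nat e2 -e1 eE; field; first by rewrite rc1 r2.
apply: vanishingM l0 _; apply: regularM; first exact: regular_rho.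
apply: regularD a2 _; apply/regularN/regularM; first exact: invertible_regular.
apply: regularM; first exact: regular_rho.
by apply/invertible_regular/invertibleV/inv_iota.
Qed.

End Place.

(** * Euler characteristics of the Taylor complexes *)

Section EulerCharacteristic.
Variables (k : fieldType) (d : nat) (Z : {fset 'X_{1..d}}).
Hypothesis ZP : order_ideal Z.

Local Notation m := (size (mingens Z)).
Local Notation V := {ffun {set 'I_m} -> k^o}.

Lemma dim_ext_cochains (i : nat) (w : weight d) :
  \dim (ext_cochains k Z i w)
  = #|[pred S : {set 'I_m} |
        (#|S| == i.+1) && in_ideal Z (w + exp_weight (glcm S))]|.
Proof.
have e_neq0 S : [ffun S' => (S' == S)%:R] != 0 :> V.
  by apply/eqP => /ffunP/(_ S); rewrite !ffunE eqxx => /eqP; rewrite oner_eq0.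
rewrite /ext_cochains (directvP _) /=; last first.
  apply/directv_sum_independent => us usP us0 S SP.
  have /vlineP[c uS] := usP S SP.
  move/ffunP/(_ S): us0; rewrite sum_ffunE (bigD1 S) //= big1 => [|T /andP[TP TS]].
    by rewrite uS !ffunE eqxx addr0 => /eqP; rewrite scaler_eq0 oner_eq0 orbF
      => /eqP ->; rewrite scale0r.
  by have /vlineP[c' ->] := usP T TP; rewrite !ffunE eq_sym (negPf TS) scaler0.
by rewrite -sum1_card; apply: eq_bigr => S _; rewrite dim_vline e_neq0.
Qed.

Lemma dim_cocycles_coboundaries (i : nat) (w : weight d) :
  (\dim (ext_cocycles k Z i w) + \dim (ext_coboundaries k Z i.+1 w))%N
  = \dim (ext_cochains k Z i w).
Proof. exact: limg_ker_dim. Qed.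

Lemma coboundaries_le_cocycles (i : nat) (w : weight d) :
  (\dim (ext_coboundaries k Z i w) <= \dim (ext_cocycles k Z i w))%N.
Proof.
by apply/dimvS/(subv_trans (ext_coboundaries_sub k i w ZP)); rewrite capvSl.
Qed.

Lemma dim_coboundaries_top (w : weight d) : \dim (ext_coboundaries k Z m w) = 0%N.
Proof.
apply/eqP; rewrite -leqn0 (leq_trans (coboundaries_le_cocycles m w)) //.
rewrite (leq_trans (dimvS (capvSl _ _))) // dim_ext_cochains leqn0.
apply/eqP/eq_card0 => S; rewrite !inE; apply/negP => /andP[/eqP Sm _].
by have := max_card [pred x in S]; rewrite Sm card_ord ltnn.
Qed.

Lemma trace_free_cocycles0 (w : weight d) :
  (ext_cocycles k Z 0 w :&: lker (linfun (ext_trace (k:=k) (Z:=Z) 0)) = 0)%VS.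
Proof.
apply/eqP; rewrite -subv0; apply/subvP => f; rewrite memv_cap memv_ker lfunE /=.
move=> /andP[fc /eqP f0]; rewrite memv0; apply/eqP/ffunP => S; rewrite ffunE.
have [//|fS] := eqVneq (f S) 0.
have [/ext_cochainsP/(_ S fS)[S1 _]] : f \in ext_cochains k Z 0 w.
  by move: fc; rewrite memv_cap => /andP[].
have /cards1P[j ->] : #|S| == 1%N by rewrite S1.
by rewrite (ext_trace_gen j fc).
Qed.

Lemma glcm1 (j : 'I_m) : glcm [set j]%SET = mingen j.
Proof. by rewrite /glcm big_set1E mlcm0. Qed.

(** The cocycles of degree 0 are the multiples of the inclusion of the ideal; it is
    the coboundary of the basis element attached to the empty set of generators. *)
Lemma dim_cocycles0 (w : weight d) : (0 < m)%N ->
  \dim (ext_cocycles k Z 0 w)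
  = [forall j : 'I_m, in_ideal Z (w + exp_weight (mingen j))] :> nat.
Proof.
move=> m_gt0; pose u : V := taylor_codiff [ffun S => (S == finset.set0)%:R].
have uE S : u S = (#|S| == 1%N)%:R.
  rewrite /u ffunE; have [/cards1P[j ->]|S1] := boolP (#|S| == 1%N).
    rewrite big_set1 ffunE finset.setDv eqxx mulr1 /taylor_sign eq_card0 // => i.
    by rewrite !inE; case: eqP => // ->; rewrite ltnn.
  rewrite big1 // => j jS; rewrite ffunE -cards_eq0.
  by case: eqP => [S0|_]; [move: S1; rewrite (cardsD1 j) jS S0 | rewrite mulr0].
have [/forallP wP|] := boolP [forall j : 'I_m,
  in_ideal Z (w + exp_weight (mingen j))]; last first.
  rewrite negb_forall => /existsP[j jw].
  apply/eqP; rewrite dimv_eq0 -subv0; apply/subvP => f fc; rewrite memv0.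
  have fcc : f \in ext_cochains k Z 0 w by move: fc; rewrite memv_cap => /andP[].
  have f0 : ext_trace 0 f = 0.
    rewrite -(ext_trace_gen j fc); apply/eqP; apply: contraNT jw.
    by move: fcc => /ext_cochainsP/[apply] -[_]; rewrite glcm1.
  have : f \in (ext_cocycles k Z 0 w :&: lker (linfun (ext_trace (k:=k) (Z:=Z) 0)))%VS.
    by rewrite memv_cap fc memv_ker lfunE; apply/eqP.
  by rewrite trace_free_cocycles0 memv0.
have uc : u \in ext_cocycles k Z 0 w.
  rewrite memv_cap memv_ker lfunE /= /u taylor_codiffK eqxx andbT.
  apply/ext_cochainsP => S; rewrite -/u uE.
  have [/cards1P[j ->] _|_] := boolP (#|S| == 1%N); last by rewrite eqxx.
  by rewrite glcm1 cards1.
have u0 : u != 0.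
  apply/eqP => /ffunP/(_ [set Ordinal m_gt0]%SET); rewrite uE cards1 ffunE => /eqP.
  by rewrite oner_eq0.
suff -> : (ext_cocycles k Z 0 w = <[u]>)%VS by rewrite dim_vline u0.
apply/eqP; rewrite eqEsubv -memvE uc andbT; apply/subvP => f fc; apply/vlineP.
exists (ext_trace 0 f); apply/ffunP => S; rewrite [RHS]ffunE uE.
have [/cards1P[j ->]|S1] := boolP (#|S| == 1%N).
  by rewrite (ext_trace_gen j fc); exact/esym/mulr1.
rewrite scaler0; apply/eqP; apply: contraNT S1.
have /ext_cochainsP fcc : f \in ext_cochains k Z 0 w.
  by move: fc; rewrite memv_cap => /andP[].
by move=> /fcc[->].
Qed.

(** The Euler characteristic of the cohomology is that of the cochains, and the
    trace-free part lacks the cocycles of degree 0, which are scalars. *)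
Lemma ext0_charE (w : weight d) : (0 < m)%N ->
  ext0_char k Z w =
    \sum_(S : {set 'I_m} | S != finset.set0)
       (-1) ^+ #|S|.-1 * (in_ideal Z (w + exp_weight (glcm S)) : nat)%:Z
    - ([forall j : 'I_m, in_ideal Z (w + exp_weight (mingen j))] : nat)%:Z.
Proof.
move=> m_gt0; pose z i := (\dim (ext_cocycles k Z i w))%:Z.
pose b i := (\dim (ext_coboundaries k Z i w))%:Z.
have b0 : b 0%N = 0 by rewrite /b /ext_coboundaries dimv0.
have bm : b m = 0 by rewrite /b dim_coboundaries_top.
have extE i : (ext0_dim k Z i w)%:Z = z i - b i - (i == 0%N)%:R * z 0%N.
  rewrite /ext0_dim /z /b; case: i => [|i].
    by rewrite trace_free_cocycles0 !dimv0 mul1r subr0 subrr.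
  rewrite mul0r subr0 subzn ?coboundaries_le_cocycles //; congr (\dim _ - _)%N%:Z.
  apply/capv_idPl/subvP => f _; rewrite memv_ker lfunE; exact: eqxx.
rewrite /ext0_char -dim_cocycles0 // -/(z 0%N).
have -> : \sum_(S : {set 'I_m} | S != finset.set0)
     (-1) ^+ #|S|.-1 * (in_ideal Z (w + exp_weight (glcm S)) : nat)%:Z
   = \sum_(i < m) (-1) ^+ i * (z i + b i.+1).
  under [RHS]eq_bigr => i _.
    rewrite -PoszD dim_cocycles_coboundaries dim_ext_cochains -sum1_card big_mkcond.
    rewrite -[Posz _]natz natr_sum mulr_sumr.
    over.
  rewrite exchange_big big_mkcond /=; apply: eq_bigr => S _.
  case: ifPn => [S0|]; last first.
    by rewrite negbK => /eqP ->; rewrite big1 // => i _; rewrite inE cards0 mulr0.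
  have Sm : (#|S|.-1 < m)%N.
    by rewrite prednK ?card_gt0 // -[X in (_ <= X)%N]card_ord max_card.
  rewrite (bigD1 (Ordinal Sm)) //= inE prednK ?card_gt0 // eqxx /=.
  rewrite big1 ?addr0 => [|i]; first by case: in_ideal.
  rewrite -val_eqE /= inE => iS; rewrite (_ : (#|S| == i.+1) = false) ?mulr0 //.
  by apply: contraNF iS => /eqP ->.
have telescope M : \sum_(i < M) (-1) ^+ i * (ext0_dim k Z i w)%:Z =
    \sum_(i < M) (-1) ^+ i * (z i + b i.+1) - b 0%N + (-1) ^+ M * b M
    - (0 < M)%N%:R * z 0%N.
  elim: M => [|M IH]; first by rewrite !big_ord0 expr0 ltnn /=; ring.
  rewrite !big_ord_recr /= IH extE exprS; case: M {IH} => [|M] /=; ring.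
by rewrite telescope b0 bm m_gt0 /=; ring.
Qed.

End EulerCharacteristic.

(** * Boxes *)

Definition below (m : nat) (x : int) : int := (0 <= x < m%:Z)%R%:R.

(** The multiplicity of t^w in
      Q Q^dual prod_i (1 - 1/t_i) - Q - (-1)^d Q^dual / (t_1 ... t_d)
    for Q = prod_i (1 + t_i + ... + t_i^(n i - 1)). Note that -1 - x lies in
    {0, ..., m - 1} if and only if - m <= x < 0. *)
Definition box_char (d : nat) (n : 'I_d -> nat) (w : weight d) : int :=
  \prod_i (below (n i) (w i) - below (n i) (-1 - w i))
  - \prod_i below (n i) (w i) - \prod_i (- below (n i) (-1 - w i)).

Lemma prodr_forall (I : finType) (P : pred I) :
  \prod_i (P i)%:R = [forall i, P i]%:R :> int.
Proof.
have [/forallP PP|] := boolP [forall i, P i]; first by rewrite big1 // => i _; rewrite PP.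
by rewrite negb_forall => /existsP[i /negPf Pi]; rewrite (bigD1 i) //= Pi mul0r.
Qed.

Lemma sum_sign_subsets (I : finType) (f : I -> bool -> int) :
  \sum_(S : {set I}) (-1) ^+ #|S| * \prod_i f i (i \in S)
  = \prod_i (f i false - f i true).
Proof.
under [RHS]eq_bigr do rewrite addrC.
rewrite bigA_distr; apply: eq_bigr => S _.
rewrite -prodr_const [X in X * _]big_mkcond -big_split; apply: eq_bigr => i _.
by case: (i \in S); [exact: mulN1r | exact: mul1r].
Qed.

Section Box.
Variables (k : fieldType) (d : nat) (n : 'I_d -> nat) (Z : {fset 'X_{1..d}}).
Hypothesis n_gt0 : forall i, (0 < n i)%N.
Hypothesis ZE : forall u : 'X_{1..d}, (u \in Z) = [forall i, (u i < n i)%N].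

Local Notation m := (size (mingens Z)).

Lemma box_order_ideal : order_ideal Z.
Proof.
move=> u v /mnm_lepP uv; rewrite !ZE => /forallP vn; apply/forallP => i.
exact: leq_ltn_trans (uv i) (vn i).
Qed.

Lemma box_mingens (v : 'X_{1..d}) :
  reflect (exists i, v = (U_(i) *+ n i)%MM) (v \in mingens Z).
Proof.
rewrite mingensP !ZE; apply: (iffP andP) => [[]|[i ->]].
  move=> /forallPn[i] ; rewrite -leqNgt => nv /forallP vZ.
  have vi : (0 < v i)%N by apply: leq_trans nv.
  exists i; apply/mnmP => j; rewrite mulmnE mnm1E.
  have [<-|ij] := eqVneq i j.
    rewrite mul1n; apply/eqP; rewrite eqn_leq nv andbT.
    have := vZ i; rewrite vi ZE => /forallP/(_ i).
    by rewrite mnmBE mnm1E eqxx; lia.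
  rewrite mul0n; apply/eqP; rewrite -leqn0 leqNgt; apply/negP => vj.
  have := vZ j; rewrite vj ZE => /forallP/(_ i).
  by rewrite mnmBE mnm1E eq_sym (negPf ij) subn0 ltnNge nv.
split; first by apply/forallPn; exists i; rewrite mulmnE mnm1E eqxx mul1n ltnn.
apply/forallP => j; apply/implyP; rewrite mulmnE mnm1E.
case: eqVneq => [<- _|]; last by rewrite mul0n.
rewrite ZE; apply/forallP => l; rewrite mnmBE mulmnE !mnm1E.
by have := n_gt0 l; case: eqVneq => [->|]; lia.
Qed.

Lemma mingens_uniq : uniq (mingens Z).
Proof. by rewrite filter_uniq ?undup_uniq. Qed.

Lemma box_gen_exists (j : 'I_m) : exists i, mingen j == (U_(i) *+ n i)%MM.
Proof.
by have /box_mingens[i e] := mem_nth 0%MM (ltn_ord j); exists i; apply/eqP.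
Qed.

Definition gen_index (j : 'I_m) : 'I_d := xchoose (box_gen_exists j).

Lemma mingenE (j : 'I_m) : mingen j = (U_(gen_index j) *+ n (gen_index j))%MM.
Proof. exact/eqP/(xchooseP (box_gen_exists j)). Qed.

Lemma gen_index_bij : bijective gen_index.
Proof.
have inj : injective gen_index.
  move=> i j ij; apply/val_inj/eqP => /=.
  rewrite -(nth_uniq 0%MM (ltn_ord i) (ltn_ord j) mingens_uniq).
  by apply/eqP; rewrite [LHS](mingenE i) [RHS](mingenE j) ij.
apply: inj_card_bij => //; rewrite !card_ord.
have : uniq [seq (U_(i) *+ n i)%MM | i <- enum 'I_d].
  rewrite map_inj_uniq ?enum_uniq // => i j /mnmP/(_ i).
  rewrite !mulmnE !mnm1E eqxx; have := n_gt0 i; case: eqVneq => //; lia.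
move=> Ug; rewrite -[leqLHS]size_enum_ord -(size_map (fun i => U_(i) *+ n i)%MM).
apply: uniq_leq_size Ug _ => v /mapP[i _ ->]; apply/box_mingens; by exists i.
Qed.

Lemma box_glcm (S : {set 'I_m}) (i : 'I_d) :
  glcm S i = if i \in gen_index @: S then n i else 0%N.
Proof.
have -> : glcm S i = \max_(j in S) mingen j i.
  rewrite /glcm (big_morph (fun v : 'X_{1..d} => v i) (id1 := 0%N) (op1 := maxn)) //.
    by move=> u v; rewrite mlcmE mnmDE mnmBE maxnE.
  exact: mnm0E.
have [/imsetP[j jS ->]|iS] := boolP (i \in gen_index @: S).
  apply/eqP; rewrite eqn_leq; apply/andP; split.
    apply/bigmax_leqP => l _; rewrite mingenE mulmnE mnm1E.
    by case: eqVneq => [->|]; rewrite ?mul1n.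
  have := leq_bigmax_cond (F := fun l => mingen l (gen_index j)) _ jS.
  by rewrite mingenE mulmnE mnm1E eqxx mul1n.
apply/eqP; rewrite -leqn0; apply/bigmax_leqP => j jS; rewrite mingenE mulmnE mnm1E.
by case: eqVneq iS => [<-|//]; rewrite imset_f.
Qed.

Lemma box_in_ideal (w : weight d) :
  (in_ideal Z w : nat)%:Z = \prod_i (0 <= w i)%R%:R - \prod_i below (n i) (w i).
Proof.
rewrite /below !prodr_forall /in_ideal ZE.
have [/forallP w0|] := boolP [forall i, 0 <= w i]; last first.
  move=> /forallPn[i wi] /=; case: forallP => // /(_ i).
  by rewrite (negPf wi).
rewrite (_ : [forall i, 0 <= w i < n i] = [forall i, [multinom `|w i|%N | i < d] i < n i]%N).
  by case: [forall i, _].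
by apply: eq_forallb => i; rewrite mnmE w0 /= -ltz_nat gez0_abs.
Qed.

Lemma card_box_mingens : m = d.
Proof. by have := bij_eq_card gen_index_bij; rewrite !card_ord. Qed.

(** The generators of the ideal are the x_i^(n i), so the Taylor complex is a Koszul
    complex, and its Euler characteristics are products over the coordinates. *)
Theorem ext0_char_box (w : weight d) : (1 < d)%N ->
  ext0_char k Z w = box_char n w.
Proof.
move=> d_gt1; have m_gt0 : (0 < m)%N by rewrite card_box_mingens ltnW.
rewrite (ext0_charE _ box_order_ideal) //.
pose v i (b : bool) : int := w i + (if b then n i else 0%N)%:Z.
pose F (S : {set 'I_m}) := (in_ideal Z (w + exp_weight (glcm S)) : nat)%:Z.
pose G (T : {set 'I_d}) :=
  \prod_i (0 <= v i (i \in T))%R%:R - \prod_i below (n i) (v i (i \in T)).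
have FG S : F S = G (gen_index @: S).
  rewrite /F box_in_ideal; congr (_ - _); apply: eq_bigr => i _;
  by rewrite !ffunE box_glcm.
have -> : \sum_(S : {set 'I_m} | S != finset.set0) (-1) ^+ #|S|.-1 * F S
    = F finset.set0 - \sum_(S : {set 'I_m}) (-1) ^+ #|S| * F S.
  rewrite [X in _ - X](bigD1 finset.set0) //= cards0 mul1r opprD addrA subrr sub0r.
  rewrite -sumrN; apply: eq_bigr => S S0.
  by rewrite -[in RHS](prednK (n := #|S|)) ?card_gt0 // exprS mulN1r mulNr opprK.
have [h hK Kh] := gen_index_bij.
have -> : \sum_(S : {set 'I_m}) (-1) ^+ #|S| * F S
    = \sum_(T : {set 'I_d}) (-1) ^+ #|T| * G T.
  rewrite [RHS](reindex (fun S : {set 'I_m} => gen_index @: S)) /=.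
    by apply: eq_bigr => S _; rewrite FG card_imset //; apply: can_inj hK.
  exists (fun T : {set 'I_d} => h @: T) => T _; rewrite -imset_comp -[RHS]imset_id;
  by apply: eq_imset => i /=; rewrite ?hK ?Kh.
rewrite /G (eq_bigr _ (fun _ _ => mulrBr _ _ _)) sumrB.
rewrite (sum_sign_subsets (fun i b => (0 <= v i b)%R%:R)).
rewrite (sum_sign_subsets (fun i b => below (n i) (v i b))).
rewrite FG /G imset0 /box_char.
have -> : ([forall j : 'I_m, in_ideal Z (w + exp_weight (mingen j))] : nat)%:Z
    = \prod_i (0 <= w i)%R%:R.
  rewrite prodr_forall natz; congr (Posz (nat_of_bool _)).
  apply/forallP/forallP => [wI i|w0 j].
    have [i' ii'] : exists i', i' != i.
      exists (if i == Ordinal d_gt1 then Ordinal (ltnW d_gt1) else Ordinal d_gt1).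
      by case: (eqVneq i (Ordinal d_gt1)) => [->//|]; rewrite eq_sym.
    have /andP[/forallP/(_ i) + _] := wI (h i').
    by rewrite !ffunE mingenE Kh mulmnE mnm1E (negPf ii') mul0n addr0.
  apply/andP; split; first by apply/forallP => i; rewrite !ffunE addr_ge0.
  rewrite ZE; apply/forallPn; exists (gen_index j).
  rewrite mnmE !ffunE mingenE mulmnE mnm1E eqxx mul1n -leqNgt.
  by rewrite -lez_nat gez0_abs ?addr_ge0 // lerDr.
have v0 i : v i false = w i by rewrite /v addr0.
rewrite (eq_bigr (fun i => (0 <= w i)%R%:R)) => [|i _]; last by rewrite finset.in_set0 v0.
rewrite [X in _ - X - _ - _](eq_bigr (fun i => below (n i) (w i))) => [|i _]; last first.
  by rewrite finset.in_set0 v0.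
have -> : \prod_i ((0 <= v i false)%R%:R - (0 <= v i true)%R%:R)
    = \prod_i - below (n i) (-1 - w i) :> int.
  apply: eq_bigr => i _; rewrite v0 /v /below; have := n_gt0 i; lia.
have -> : \prod_i (below (n i) (v i false) - below (n i) (v i true))
    = \prod_i (below (n i) (w i) - below (n i) (-1 - w i)).
  apply: eq_bigr => i _; rewrite v0 /v /below; have := n_gt0 i; lia.
ring.
Qed.

End Box.

(** * The character of a box *)

Section BoxCharacter.
Local Open Scope classical_set_scope.
Variables (d : nat) (n : 'I_d -> nat).

Definition box : set (weight d) := [set w | forall i, - (n i)%:Z <= w i < (n i)%:Z].

(** Serre duality exchanges w and (-1, ..., -1) - w. *)
Definition dual_weight (w : weight d) : weight d := [ffun i => -1 - w i].

Definition minus_indicator (A : {set 'I_d}) : weight d :=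
  [ffun i => - (i \in A)%:R].

Lemma dual_weightK : involutive dual_weight.
Proof. by move=> w; apply/ffunP => i; rewrite !ffunE opprB addrC subrK. Qed.

Lemma finite_box : finite_set box.
Proof.
pose N := (\sum_i n i)%N.
apply: (@sub_finite_set _ _
  ((fun f : {ffun 'I_d -> 'I_(N + N).+1} => [ffun i => (f i)%:Z - N%:Z] : weight d)
     @` [set: {ffun 'I_d -> 'I_(N + N).+1}])); last exact/finite_image/finite_finset.
move=> w wB; exists [ffun i => inord (absz (w i + N%:Z))] => //.
apply/ffunP => i; rewrite !ffunE.
have nN : (n i <= N)%N by rewrite /N (bigD1 i) //= leq_addr.
move: (wB i) nN; move: (w i) (n i) (N) => x a M xa aM; rewrite inordK; lia.
Qed.

Lemma box_char_dual (w : weight d) :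
  box_char n (dual_weight w) = (-1) ^+ d * box_char n w.
Proof.
have e : \prod_(i < d) (-1 : int) = (-1) ^+ d by rewrite prodr_const card_ord.
have eK (F : 'I_d -> int) : (-1) ^+ d * \prod_i F i = \prod_i - F i.
  by rewrite -e -big_split; apply: eq_bigr => i _; exact: mulN1r.
have dK i : -1 - dual_weight w i = w i by rewrite ffunE; ring.
rewrite /box_char !mulrBr !eK addrAC; congr (_ - _ - _); apply: eq_bigr => i _;
by rewrite ?dK ?ffunE ?opprB ?opprK.
Qed.

(** If no entry is negative, then the second product cancels the first one and the
    third one is 0; if all of them are, then the roles are exchanged. *)
Lemma box_char_support (w : weight d) : (0 < d)%N -> box_char n w != 0 ->
  [/\ box w, exists i, w i < 0 & exists i, 0 <= w i].
Proof.
move=> d_gt0 w0; pose i0 := Ordinal d_gt0; split.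
- move=> i; apply: contraNT w0 => wi; rewrite /box_char.
  rewrite !(bigD1 (P := xpredT) i) //= /below.
  have -> : (0 <= w i < (n i)%:Z) = false by lia.
  have -> : (0 <= -1 - w i < (n i)%:Z) = false by lia.
  by rewrite subr0 oppr0 !mul0r.
- apply/existsP; apply: contraNT w0; rewrite negb_exists => /forallP w0.
  have q0 i : below (n i) (-1 - w i) = 0 by have := w0 i; rewrite /below; lia.
  rewrite /box_char [X in _ - X](bigD1 i0) //= q0 oppr0 mul0r subr0 subr_eq0.
  by apply/eqP/eq_bigr => i _; rewrite q0 subr0.
- apply/existsP; apply: contraNT w0; rewrite negb_exists => /forallP w0.
  have p0 i : below (n i) (w i) = 0 by have := w0 i; rewrite /below; lia.
  rewrite /box_char [X in _ - X - _](bigD1 i0) //= p0 mul0r subr0 subr_eq0.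
  by apply/eqP/eq_bigr => i _; rewrite p0 sub0r.
Qed.
Lemma box_char_minus_indicator (A : {set 'I_d}) : (forall i, (0 < n i)%N) ->
  A != finset.set0 -> A != finset.setT ->
  box_char n (minus_indicator A) = (-1) ^+ #|A|.
Proof.
move=> n_gt0 A0 AT; rewrite /box_char.
have pE i : below (n i) (minus_indicator A i) = (i \notin A)%:R.
  by rewrite /below ffunE; have := n_gt0 i; case: (i \in A) => /=; lia.
have qE i : below (n i) (-1 - minus_indicator A i) = (i \in A)%:R.
  by rewrite /below ffunE; have := n_gt0 i; case: (i \in A) => /=; lia.
have [i iA] := finset.set0Pn _ A0.
have [j jA] : exists j, j \notin A.
  apply/existsP; apply: contraNT AT; rewrite negb_exists => /forallP AT.
  by apply/eqP/finset.setP => j; rewrite !inE; apply/negPn/AT.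
rewrite [X in _ - X - _](bigD1 i) //= pE iA mul0r subr0.
rewrite [X in _ - X](bigD1 j) //= qE (negPf jA) oppr0 mul0r subr0.
rewrite -prodr_const [RHS]big_mkcond; apply: eq_bigr => l _; rewrite pE qE.
by case: (l \in A).
Qed.

Lemma fsbig_involution (T : choiceType) (R : Type) (idx : R)
    (op : Monoid.com_law idx) (h : T -> T) (P Q : set T) (F : T -> R) :
    involutive h -> (forall x, P x -> Q (h x)) -> (forall x, Q x -> P (h x)) ->
  \big[op/idx]_(x \in Q) F x = \big[op/idx]_(x \in P) F (h x).
Proof.
move=> hK hPQ hQP; apply: reindex_fsbig; split => //.
- by move=> x y _ _ /(congr1 h); rewrite !hK.
- by move=> y Qy; exists (h y); [apply: hQP | rewrite hK].
Qed.

(** The first product in box_char changes sign under the reflection of the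
    coordinate c', so that its sum is 0; the second one is the indicator function of
    Z; the third one vanishes where w c >= 0. *)
Lemma sum_half_box_char (Z : {fset 'X_{1..d}}) (c c' : 'I_d) : c' != c ->
    (forall u : 'X_{1..d}, (u \in Z) = [forall i, (u i < n i)%N]) ->
  \sum_(w \in box `&` [set w | 0 <= w c]) box_char n w = - (#|` Z|)%:Z.
Proof.
move=> cc' ZE; set H := _ `&` _.
have finH : finite_set H by apply: finite_setIl; exact: finite_box.
have HE w : H w -> box_char n w
    = \prod_i (below (n i) (w i) - below (n i) (-1 - w i)) - \prod_i below (n i) (w i).
  move=> [_ /= wc]; rewrite /box_char [X in _ - X](bigD1 c) //=.
  have -> : below (n c) (-1 - w c) = 0 by rewrite /below; lia.
  by rewrite oppr0 mul0r subr0.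
transitivity (\sum_(w \in H) (\prod_i (below (n i) (w i) - below (n i) (-1 - w i))
   - \prod_i below (n i) (w i))).
  by apply: eq_fsbigr => w; rewrite inE => /HE.
rewrite fsbig_split //=.
have -> : \sum_(w \in H) \prod_i (below (n i) (w i) - below (n i) (-1 - w i)) = 0.
  set s := (X in X = 0); suff : s = - s by lia.
  pose h (w : weight d) : weight d := [ffun i => if i == c' then -1 - w i else w i].
  have hH w : H w -> H (h w).
    move=> [wB /= wc]; split => /= [i|]; rewrite ffunE; last by rewrite eq_sym (negPf cc').
    by have := wB i; case: eqP => //; lia.
  rewrite {1}/s (fsbig_involution _ (h := h) (P := H)) //; last first.
    by move=> w; apply/ffunP => i; rewrite !ffunE; case: eqP => // _; ring.
  rewrite /s -[RHS]mulN1r mulr_fsumr; apply: eq_fsbigr => w _.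
  rewrite (bigD1 c') //= [in RHS](bigD1 c') //= mulrA mulN1r opprB.
  congr (_ * _); first by rewrite !ffunE eqxx; congr (_ - below _ _); ring.
  by apply: eq_bigr => i /negPf ic'; rewrite !ffunE ic'.
rewrite add0r; under eq_fsbigr do rewrite -mulN1r; rewrite -mulr_fsumr mulN1r.
congr (- _); transitivity (\sum_(w \in @exp_weight d @` [set` Z]) \prod_i below (n i) (w i)).
  apply/esym/fsbig_widen.
    move=> _ [u /= uZ <-]; move: uZ; rewrite ZE => /forallP uZ.
    by split => [i|] /=; rewrite ffunE // ltz_nat uZ andbT; lia.
  move=> w [[wB /= wc] wZ]; rewrite /below prodr_forall.
  rewrite (_ : [forall i, _] = false) //; apply/negP => /forallP w0; apply: wZ.
  exists [multinom absz (w i) | i < d]; last first.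
    by apply/ffunP => i; rewrite ffunE mnmE gez0_abs //; case/andP: (w0 i).
  rewrite /= ZE; apply/forallP => i; rewrite mnmE; case/andP: (w0 i) => wi.
  by rewrite -ltz_nat gez0_abs.
rewrite fsbig_image; last first.
  move=> u v _ _ /ffunP uv; apply/mnmP => i.
  by have := uv i; rewrite !ffunE => -[].
rewrite -fsbig_seq ?fset_uniq // big_seq (eq_bigr (fun _ => 1)) -?big_seq.
  by rewrite big_const_seq count_predT iter_addr_0 natz.
move=> u; rewrite ZE => /forallP uZ; rewrite big1 // => i _.
by rewrite /below ffunE ltz_nat uZ.
Qed.

End BoxCharacter.

(** * Euler classes as products over boxes *)

Section EulerProducts.
Local Open Scope classical_set_scope.

Lemma fsbig_closed (T : choiceType) (R : Type) (idx : R) (op : Monoid.com_law idx)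
    (P : R -> Prop) (A : set T) (F : T -> R) :
    P idx -> (forall x y, P x -> P y -> P (op x y)) ->
    (forall x, A x -> P (F x)) ->
  P (\big[op/idx]_(x \in A) F x).
Proof.
move=> P0 PD PF; case: finite_supportP => [|X XA _ _]; first by rewrite big_nil.
by rewrite big_seq; elim/big_ind: _ => [|x y|x xX]; [|exact: PD|exact/PF/XA].
Qed.

Lemma exprz_sum (F : fieldType) (x : F) (I : Type) (r : seq I) (P : pred I)
    (a : I -> int) : x != 0 ->
  x ^ (\sum_(i <- r | P i) a i) = \prod_(i <- r | P i) x ^ a i.
Proof. by move=> x0; apply: big_morph => // m n; exact: expfzDr. Qed.

Variables (d : nat) (F : fieldType) (lam : 'I_d -> F).

Lemma chern1_dual (w : weight d) : \sum_i lam i = 0 ->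
  chern1 lam (dual_weight w) = - chern1 lam w.
Proof.
move=> lam0; rewrite -[RHS]sub0r -[X in X - _]oppr0 -lam0 -sumrN -sumrB.
by apply: eq_bigr => i _; rewrite ffunE mulrzBr mulrN1z.
Qed.

Lemma chern1_shift (w : weight d) (c : int) : \sum_i lam i = 0 ->
  chern1 lam [ffun i => w i + c] = chern1 lam w.
Proof.
move=> lam0; transitivity (chern1 lam w + (\sum_i lam i) *~ c).
  by rewrite mulrz_suml -big_split; apply: eq_bigr => i _; rewrite ffunE mulrzDr.
by rewrite lam0 mul0rz addr0.
Qed.

Lemma eulerT (A : set (weight d)) (a : weight d -> int) :
    (forall w, a w != 0 -> A w) ->
  euler lam setT a = \big[*%R/1]_(w \in A) chern1 lam w ^ a w.
Proof.
move=> aA; apply/esym/fsbig_widen => // w [_ wA] /=.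
by have [->|/aA//] := eqVneq (a w) 0.
Qed.

(** Characters with the same restriction differ by a multiple of (1, ..., 1), so they
    have the same Chern class x, and their factors x^m can be collected. The rule
    x^(m + n) = x^m x^n requires x != 0. *)
Lemma euler_cy_restrict (A : set (weight d)) (a : weight d -> int) :
    (0 < d)%N -> \sum_i lam i = 0 -> finite_set A ->
    (forall w, a w != 0 -> A w) ->
    (forall w, A w -> a w != 0 -> chern1 lam w != 0) ->
  euler lam (cy_weights d) (cy_restrict a)
    = \big[*%R/1]_(w \in A) chern1 lam w ^ a w.
Proof.
move=> d_gt0 lam0 finA aA chi0; pose i0 := Ordinal d_gt0.
pose norm (w : weight d) : weight d := [ffun i => w i - w i0].
pose s := fset_set A.
have sA w : (w \in s) = (w \in A) by rewrite in_fset_set.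
have normK w : cy_weights d w -> norm w = w.
  by move=> cw; apply/ffunP => i; rewrite ffunE (cw i0) // subr0.
have cy_norm w : cy_weights d (norm w).
  by move=> i i00; rewrite ffunE (_ : i = i0) ?subrr //; apply: val_inj.
have chi_norm w : chern1 lam (norm w) = chern1 lam w by apply: chern1_shift.
have restrictE w : cy_weights d w ->
    cy_restrict a w = \sum_(v <- s | norm v == w) a v.
  move=> cw; pose h (c : int) : weight d := [ffun i => w i + c].
  have hinj : set_inj setT h.
    by move=> c c' _ _ /ffunP/(_ i0); rewrite !ffunE => /addrI.
  rewrite -[LHS](fsbig_image _ _ a hinj).
  rewrite (fsbigE [seq v <- s | norm v == w]) ?filter_uniq ?fset_uniq //.
  - rewrite big_filter_cond; apply: eq_bigl => v.
    have [nv|//] := eqVneq (norm v) w; rewrite /= mem_set //.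
    by exists (v i0) => //; apply/ffunP => i; rewrite ffunE -nv ffunE subrK.
  - move=> v /=; rewrite mem_filter => /andP[/eqP nv _].
    by exists (v i0) => //; apply/ffunP => i; rewrite ffunE -nv ffunE subrK.
  - move=> v [c _ <-]; rewrite mem_filter sA => hN.
    apply: contraNeq hN => /aA ac; rewrite mem_set // andbT.
    by apply/eqP/ffunP => i; rewrite !ffunE (cw i0) //; ring.
pose t := [fset norm v | v in s]%fset.
have tP w : w \in t -> exists2 v, v \in s & w = norm v by move=> /imfsetP.
rewrite fsbig_finite // (partition_big_imfset _ norm) -/s -/t /= /euler.
rewrite (fsbigE t) ?fset_uniq //.
- rewrite big_seq_cond [RHS]big_seq_cond; apply: eq_big => w.
    by rewrite andbT; have [/tP[v _ ->]|//] := boolP (w \in t); rewrite mem_set.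
  move=> /andP[_]; rewrite inE => cw; rewrite restrictE //.
  rewrite big_seq_cond [RHS]big_seq_cond.
  elim/big_rec2: _ => [|v x y /andP[vs /eqP nv] <-]; first exact: expr0z.
  have [->|av] := eqVneq (a v) 0; first by rewrite expr0z mul1r add0r.
  by rewrite -nv chi_norm expfzDr // chi0 //; apply: aA.
- by move=> w /= /tP[v _ ->].
- move=> w cw wt; rewrite restrictE // big1_seq ?expr0z // => v /andP[/eqP nv vs].
  by move: wt; rewrite -nv in_imfset.
Qed.

(** Serre duality pairs a weight with its dual, of opposite Chern class and of the
    same multiplicity. So one half of the product is a square root of the whole up to
    a sign, whose exponent is the sum of the multiplicities in that half. *)
Lemma box_euler_square (n : 'I_d -> nat) (Z : {fset 'X_{1..d}}) (c c' : 'I_d) :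
    ~~ odd d -> \sum_i lam i = 0 -> c' != c ->
    (forall u : 'X_{1..d}, (u \in Z) = [forall i, (u i < n i)%N]) ->
  (-1) ^+ #|` Z| * \big[*%R/1]_(w \in box n) chern1 lam w ^ box_char n w
  = (\big[*%R/1]_(w \in box n `&` [set w | 0 <= w c])
       chern1 lam w ^ box_char n w) ^+ 2.
Proof.
move=> d_even lam0 cc' ZE; set y := (X in X ^+ 2).
have finH : finite_set (box n `&` [set w | 0 <= w c]).
  by apply: finite_setIl; exact: finite_box.
rewrite (fsbigID [set w : weight d | 0 <= w c]) /=; last exact: finite_box.
rewrite -/y.
rewrite (fsbig_involution _ (h := @dual_weight d)
  (P := box n `&` [set w | 0 <= w c])); first last.
- by move=> w [wB /= wc]; split => /= [i|]; rewrite ffunE; [have := wB i|]; lia.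
- by move=> w [wB /= wc]; split => /= [i|]; rewrite ffunE; [have := wB i|]; lia.
- exact: dual_weightK.
under [X in _ * (_ * X)]eq_fsbigr => w _.
  rewrite chern1_dual // box_char_dual -signr_odd (negPf d_even) expr0 mul1r.
  rewrite -mulN1r expfzMl.
  over.
rewrite fsbig_split //= -/y.
rewrite [X in _ * (_ * (X * _))](_ : _ = (-1) ^- #|` Z|).
  by rewrite mulrCA !mulrA mulfK ?signr_eq0 // expr2.
rewrite exprnN -(sum_half_box_char cc' ZE) !fsbig_finite // exprz_sum //.
by rewrite oppr_eq0 oner_eq0.
Qed.

End EulerProducts.

(** * The first two Hilbert schemes *)

Section FixedPoints.
Local Open Scope classical_set_scope.
Variable d : nat.

Definition origin : {fset 'X_{1..d}} := [fset 0%MM]%fset.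

Definition double_point (a : 'I_d) : {fset 'X_{1..d}} := [fset 0%MM; U_(a)%MM]%fset.

Definition double_box (a i : 'I_d) : nat := (i == a).+1.

Lemma in_origin (u : 'X_{1..d}) : (u \in origin) = [forall i, (u i < 1)%N].
Proof.
rewrite inE; apply/eqP/forallP => [-> i|u0]; first by rewrite mnm0E.
by apply/mnmP => i; rewrite mnm0E; have := u0 i; lia.
Qed.

Lemma in_double_point (a : 'I_d) (u : 'X_{1..d}) :
  (u \in double_point a) = [forall i, (u i < double_box a i)%N].
Proof.
rewrite !inE; apply/orP/forallP => [[/eqP -> i|/eqP -> i]|ua].
- by rewrite mnm0E.
- by rewrite mnm1E /double_box eq_sym; case: eqP.
have [ua0|ua1] : u a = 0%N \/ u a = 1%N by have := ua a; rewrite /double_box eqxx; lia.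
  left; apply/eqP/mnmP => i; rewrite mnm0E.
  by have := ua i; rewrite /double_box; case: eqP => [->|_]; lia.
right; apply/eqP/mnmP => i; rewrite mnm1E eq_sym.
by have := ua i; rewrite /double_box; case: eqP => [->|_]; lia.
Qed.

Lemma card_double_point (a : 'I_d) : #|` double_point a| = 2.
Proof.
rewrite cardfs2 eq_sym; case: eqP => // /mnmP/(_ a).
by rewrite mnm1E mnm0E eqxx.
Qed.

Lemma mem0_order_ideal (Z : {fset 'X_{1..d}}) u :
  order_ideal Z -> u \in Z -> 0%MM \in Z.
Proof. by move=> ZP; apply: ZP; apply/mnm_lepP => i; rewrite mnm0E. Qed.

Lemma fixed_points1 : fixed_points d 1 = [set origin].
Proof.
apply/seteqP; split => [Z [ZP /eqP/cardfs1P[u Zu]]|_ ->] /=.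
  rewrite Zu; congr [fset _]%fset; apply/esym/fset1P; rewrite -Zu.
  by apply: (mem0_order_ideal (u := u)) => //; rewrite Zu fset11.
by split; [apply: (box_order_ideal in_origin) | rewrite cardfs1].
Qed.

Lemma fixed_points2 : fixed_points d 2 = double_point @` setT.
Proof.
apply/seteqP; split => [Z [ZP Z2]|_ [a _ <-]] /=; last first.
  split; [exact: (box_order_ideal (in_double_point a)) | exact: card_double_point].
have [u uZ] : exists u, u \in Z.
  by apply/fset0Pn; rewrite -cardfs_gt0 Z2.
have Z0 := mem0_order_ideal ZP uZ.
have [v] : exists v, v \in (Z `\ 0%MM)%fset.
  by apply/fset0Pn; rewrite -cardfs_gt0; have := cardfsD1 0%MM Z; rewrite Z0 Z2; lia.
rewrite !inE => /andP[v0 vZ].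
have [a va] : exists a, (0 < v a)%N.
  apply/existsP; apply: contraNT v0; rewrite negb_exists => /forallP v0.
  by apply/eqP/mnmP => i; rewrite mnm0E; have := v0 i; lia.
have aZ : U_(a)%MM \in Z by apply: ZP vZ; rewrite lep1mP -lt0n.
exists a => //; apply/eqP; rewrite eqEfcard; apply/andP; split.
  by apply/fsubsetP => w; rewrite !inE => /orP[] /eqP ->.
by rewrite Z2 card_double_point.
Qed.

End FixedPoints.

(** * Weights as linear forms *)

Section LinearForms.
Variable d : nat.

Definition linform (w : weight d) : {mpoly rat[d]} := \sum_i 'X_i *~ w i.

Lemma chern1_linform (K : fieldType) (rho : {rmorphism {mpoly rat[d]} -> K})
    (w : weight d) :
  chern1 (fun i => rho 'X_i) w = rho (linform w).
Proof. by rewrite rmorph_sum; apply: eq_bigr => i _; rewrite raddfMz. Qed.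

Lemma linform_eq0 (w : weight d) : linform w = 0 -> forall i, w i = 0.
Proof.
move=> w0 i; have := mcoeff0 rat U_(i)%MM; rewrite -w0 raddf_sum (bigD1 i) //=.
rewrite big1 => [|j /negPf ji]; last by rewrite raddfMz /= mcoeffXU ji mul0rz.
by rewrite raddfMz /= mcoeffXU eqxx addr0 => /eqP; rewrite intr_eq0 => /eqP.
Qed.

(** For r in A, substituting these polynomials is the restriction to the hyperplane
    sum_(i in A) X_i = 0, on which X_r is expressed through the other variables. *)
Definition solve (A : {set 'I_d}) (r : 'I_d) : d.-tuple {mpoly rat[d]} :=
  [tuple if i == r then - \sum_(j in A :\ r) 'X_j else 'X_i | i < d].

Lemma linform_solve (A : {set 'I_d}) (r : 'I_d) (w : weight d) : r \in A ->
  linform w \mPo solve A r = linform [ffun i => w i - (i \in A)%:R * w r].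
Proof.
move=> rA; rewrite /linform raddf_sum (bigD1 r) //= [RHS](bigD1 r) //= ffunE rA.
rewrite mul1r subrr mulr0z add0r raddfMz /= comp_mpolyXU -tnth_nth tnth_mktuple eqxx.
rewrite [X in _ + X = _](eq_bigr (fun i => 'X_i *~ w i)); last first.
  by move=> i ir; rewrite raddfMz /= comp_mpolyXU -tnth_nth tnth_mktuple (negPf ir).
under [RHS]eq_bigr do rewrite ffunE mulrzBr.
rewrite sumrB addrC; congr (_ + _); rewrite mulNrz mulrz_suml; congr (- _).
rewrite big_mkcond [RHS]big_mkcond; apply: eq_bigr => i _; rewrite !inE.
by case: (i == r); case: (i \in A); rewrite ?mul1r ?mul0r ?mulr0z.
Qed.

End LinearForms.

(** * Poles of the Euler classes *)

Section Poles.
Local Open Scope classical_set_scope.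
Variables (d : nat) (K : fieldType) (C : idomainType).
Variables (rho : {rmorphism {mpoly rat[d]} -> K}).
Variables (phi : {rmorphism {mpoly rat[d]} -> C}).

(** All factors are units except that of m, which occurs with exponent -1. *)
Lemma simple_pole_prod (S : set (weight d)) (a : weight d -> int) (m : weight d) :
    finite_set S -> S m -> a m = -1 -> rho (linform m) != 0 ->
    (forall w, S w -> a w != 0 -> phi (linform w) = 0 -> w = m) ->
  invertible rho phi (rho (linform m)
    * \big[*%R/1]_(w \in S) chern1 (fun i => rho 'X_i) w ^ a w).
Proof.
move=> finS Sm am m0 null; rewrite (fsbigD1 m) //= chern1_linform am.
rewrite mulrA mulfV // mul1r; apply: fsbig_closed => [|x y|w [Sw /= wm]].
- exact: invertible1.
- exact: invertibleM.
have [->|aw] := eqVneq (a w) 0; first exact: invertible1.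
rewrite chern1_linform; apply/invertibleXz/invertible_rho.
by apply: contra_notN wm => /eqP/(null w Sw aw).
Qed.

End Poles.

Section OddCase.
Local Open Scope classical_set_scope.
Variables (k : fieldType) (d : nat) (A : {set 'I_d}) (r : 'I_d).
Hypotheses (d_gt1 : (1 < d)%N) (rA : r \in A) (AT : A != finset.setT).
Hypothesis oddA : odd #|A|.

Definition restrict_odd : {rmorphism {mpoly rat[d]} -> {mpoly rat[d]}} :=
  comp_mpoly (solve A r).

Lemma restrict_odd_eq0 (w : weight d) :
  restrict_odd (linform w) = 0 <-> forall i, w i = (i \in A)%:R * w r.
Proof.
rewrite /restrict_odd /= linform_solve //; split => [/linform_eq0 w0 i|w0].
  by have := w0 i; rewrite ffunE => /subr0_eq.
by rewrite /linform big1 // => i _; rewrite ffunE -w0 subrr mulr0z.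
Qed.

Local Notation rho := (@FracField.tofrac {mpoly rat[d]}).

(** A weight of the box that vanishes on the hyperplane is a multiple of the
    indicator function of A. It has a negative entry, and a direction of A in which Z
    has side 1 only leaves the factor -1. The multiplicity is (-1)^|A| = -1. *)
Lemma euler_box_pole (n : 'I_d -> nat) (Z : {fset 'X_{1..d}}) :
    (forall i, (0 < n i)%N) -> (exists2 i, i \in A & n i = 1%N) ->
    (forall u : 'X_{1..d}, (u \in Z) = [forall i, (u i < n i)%N]) ->
  invertible rho restrict_odd (rho (linform (minus_indicator A))
    * euler (@lam d) setT (ext0_char k Z)).
Proof.
move=> n_gt0 [j jA nj] ZE.
have A0 : A != finset.set0 by apply/finset.set0Pn; exists r.
have am : box_char n (minus_indicator A) = -1.
  by rewrite box_char_minus_indicator // -signr_odd oddA.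
have -> : ext0_char k Z = box_char n.
  by apply/funext => w; exact: ext0_char_box.
have supp w : box_char n w != 0 -> box n w.
  by move=> w0; have [] := box_char_support (ltnW d_gt1) w0.
rewrite (eulerT _ supp); apply: simple_pole_prod => //.
- exact: finite_box.
- by apply: supp; rewrite am.
- rewrite tofrac_eq0; apply/eqP => /linform_eq0/(_ r); rewrite ffunE rA.
  by move=> /eqP; rewrite oppr_eq0 oner_eq0.
move=> w wB /(box_char_support (ltnW d_gt1))[_ [i wi] _] /restrict_odd_eq0 w0.
have wr : w r = -1.
  have := wB j; rewrite nj w0 jA mul1r; move: wi; rewrite w0.
  by case: (i \in A); rewrite ?mul0r ?ltxx // mul1r; lia.
by apply/ffunP => l; rewrite ffunE w0 wr mulrN1.
Qed.

End OddCase.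

Section EvenCase.
Local Open Scope classical_set_scope.
Variables (k : fieldType) (d : nat).

Definition rho_cy : {rmorphism {mpoly rat[d]} -> cy_field d} :=
  @FracField.tofrac (cy_ring d) \o \pi_(cy_ring d)%qT.

Lemma rho_cy_eq0 (p : {mpoly rat[d]}) :
  rho_cy p = 0 <-> exists q, p = q * lam_sum d.
Proof.
have pi0 : \pi_(cy_ring d)%qT p = 0 <-> p \in cy_ideal d.
  rewrite -[X in X \in _]subr0 Quotient.idealrBE -(rmorph0 (\pi_(cy_ring d)%qT)).
  by split => /eqP.
rewrite /rho_cy /=; split => [/eqP|[q pq]].
  by rewrite tofrac_eq0 => /eqP/pi0/asboolP.
by apply/eqP; rewrite tofrac_eq0; apply/eqP/pi0/asboolP; exists q.
Qed.

Lemma lam_sum_linform : lam_sum d = linform [ffun=> 1].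
Proof. by apply: eq_bigr => i _; rewrite ffunE. Qed.

Lemma sum_cy_lam : \sum_i @cy_lam d i = 0.
Proof.
transitivity (rho_cy (lam_sum d)); first by rewrite rmorph_sum.
by apply/rho_cy_eq0; exists 1; rewrite mul1r.
Qed.

Lemma rho_cy_linform_eq0 (w : weight d) : rho_cy (linform w) = 0 ->
  forall i j, w i = w j.
Proof.
move=> /rho_cy_eq0[q wq] i j; have jT : j \in [set: 'I_d]%SET by rewrite inE.
have := congr1 (comp_mpoly (solve [set: 'I_d]%SET j)) wq.
rewrite rmorphM /= lam_sum_linform !linform_solve //.
rewrite [X in _ * X]big1 => [|l _]; last by rewrite !ffunE inE mulr1 subrr mulr0z.
by rewrite mulr0 => /linform_eq0/(_ i); rewrite ffunE inE mul1r => /subr0_eq.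
Qed.

Lemma taut_origin (l : weight d) : (0 < d)%N -> rho_cy (linform l) != 0 ->
  cy_euler (taut_char l (origin d)) = rho_cy (linform l).
Proof.
have tautE w : taut_char l (origin d) w = (l == w)%:Z.
  rewrite /taut_char -sum1_count big_mkcond big_seq_fset1 /=.
  rewrite (_ : l + exp_weight 0%MM = l); first by case: eqP.
  by apply/ffunP => i; rewrite !ffunE mnm0E addr0.
move=> d_gt0 l0; rewrite /cy_euler (euler_cy_restrict (A := [set l])).
- by rewrite fsbig_set1 tautE eqxx expr1z (chern1_linform rho_cy).
- exact: d_gt0.
- exact: sum_cy_lam.
- exact: finite_set1.
- by move=> w; rewrite tautE /=; case: (eqVneq l w) => [->|].
- by move=> w -> _; rewrite (chern1_linform rho_cy).
Qed.

Variables (A : {set 'I_d}) (r s : 'I_d).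
Hypotheses (rA : r \in A) (sA : s \notin A) (oddA : odd #|A|) (d_even : ~~ odd d).

Let d_gt1 : (1 < d)%N.
Proof.
have := leq_ltn_trans (leq0n r) (ltn_ord r); move: d_even.
by move: (d) => [|[|e]].
Qed.

Let sr : r != s.
Proof. by apply: contraNneq sA => <-. Qed.

(** On the locus where all lambda_i have sum 0, the hyperplane of A is also that of
    the complement of A. *)
Definition restrict_even : {rmorphism {mpoly rat[d]} -> {mpoly rat[d]}} :=
  comp_mpoly (solve (~: A)%SET s) \o comp_mpoly (solve A r).

Lemma restrict_even_eq0 (w : weight d) :
  restrict_even (linform w) = 0 <-> forall i, w i = if i \in A then w r else w s.
Proof.
have e i : [ffun i => [ffun i => w i - (i \in A)%:R * w r] i
    - (i \in ~: A)%SET%:R * [ffun i => w i - (i \in A)%:R * w r] s] i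
  = w i - if i \in A then w r else w s.
  rewrite !ffunE (negPf sA) mul0r subr0 inE.
  by case: (i \in A); rewrite ?mul1r ?mul0r subr0.
rewrite /restrict_even /= !linform_solve ?inE //; split => [/linform_eq0 w0 i|w0].
  by have := w0 i; rewrite e => /subr0_eq.
by rewrite /linform big1 // => i _; rewrite e -w0 subrr mulr0z.
Qed.

Lemma rho_cy_restrict (p : {mpoly rat[d]}) : rho_cy p = 0 -> restrict_even p = 0.
Proof.
move=> /rho_cy_eq0[q ->]; rewrite rmorphM lam_sum_linform.
rewrite [X in _ * X](_ : _ = 0) ?mulr0 //; apply/restrict_even_eq0 => i.
by rewrite !ffunE if_same.
Qed.

Lemma some_sqrt_sqr (F : fieldType) (y : F) :
  some_sqrt (y ^+ 2) = y \/ some_sqrt (y ^+ 2) = - y.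
Proof.
rewrite /some_sqrt; case: xgetP => [z _ /eqP|none]; last by case: (none y).
by rewrite /= eqf_sqr => /orP[] /eqP; [left|right].
Qed.

(** In the half of the weights with w s >= 0, a weight that vanishes on the
    hyperplane is constant on A and on its complement. The value on the complement
    is nonnegative, so the one on A is negative; directions with side 1 on both sides
    leave only the values -1 on A and 0 elsewhere. *)
Lemma sqrt_cy_euler_box_pole (n : 'I_d -> nat) (Z : {fset 'X_{1..d}}) :
    (forall i, (0 < n i)%N) -> (exists2 i, i \in A & n i = 1%N) ->
    (exists2 i, i \notin A & n i = 1%N) ->
    (forall u : 'X_{1..d}, (u \in Z) = [forall i, (u i < n i)%N]) ->
  invertible rho_cy restrict_even (rho_cy (linform (minus_indicator A))
    * some_sqrt ((-1) ^+ #|` Z| * cy_euler (ext0_char k Z))).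
Proof.
move=> n_gt0 [j jA nj] [j' j'A nj'] ZE.
have A0 : A != finset.set0 by apply/finset.set0Pn; exists r.
have AT : A != finset.setT by apply: contraNneq sA => ->; rewrite inE.
have am : box_char n (minus_indicator A) = -1.
  by rewrite box_char_minus_indicator // -signr_odd oddA.
have -> : ext0_char k Z = box_char n.
  by apply/funext => w; exact: ext0_char_box.
have supp w : box_char n w != 0 -> box n w.
  by move=> w0; have [] := box_char_support (ltnW d_gt1) w0.
have chi0 w : box_char n w != 0 -> rho_cy (linform w) != 0.
  move=> /(box_char_support (ltnW d_gt1))[_ [i wi] [i' wi']].
  apply/eqP => /rho_cy_linform_eq0/(_ i i') wii'.
  by rewrite wii' ltNge wi' in wi.
rewrite /cy_euler (euler_cy_restrict (A := box n)) //; last first.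
- by move=> w _ w0; rewrite (chern1_linform rho_cy) chi0.
- exact: finite_box.
- exact: sum_cy_lam.
- exact: ltnW.
rewrite (box_euler_square d_even sum_cy_lam sr ZE); set y := \big[_/_]_(_ \in _) _.
have y_pole : invertible rho_cy restrict_even (rho_cy (linform (minus_indicator A)) * y).
  apply: simple_pole_prod => //.
  - by apply: finite_setIl; exact: finite_box.
  - split; first by apply: supp; rewrite am.
    by rewrite /= ffunE (negPf sA).
  - by rewrite chi0 // am.
  move=> w [wB /= ws] /(box_char_support (ltnW d_gt1))[_ [i wi] _].
  move=> /restrict_even_eq0 w0.
  have wr : w r = -1.
    have := wB j; rewrite nj w0 jA; move: wi; rewrite w0.
    by case: (i \in A); lia.
  have ws0 : w s = 0 by have := wB j'; rewrite nj' w0 (negPf j'A); lia.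
  by apply/ffunP => l; rewrite ffunE w0 wr ws0; case: (l \in A).
by have [->|->] := some_sqrt_sqr y; rewrite ?mulrN //; apply: invertibleN.
Qed.

Lemma regular_taut (l : weight d) (Z : {fset 'X_{1..d}}) :
  regular rho_cy restrict_even (cy_euler (taut_char l Z)).
Proof.
apply: fsbig_closed => [|x y|w _].
- exact/invertible_regular/invertible1.
- by apply: regularM; exact: rho_cy_restrict.
have : 0 <= cy_restrict (taut_char l Z) w by apply: fsumr_ge0.
rewrite (chern1_linform rho_cy); case: (cy_restrict _ _) => // n _.
rewrite -exprnP -rmorphXn; exact: regular_rho.
Qed.

End EvenCase.

(** * The series are not powers *)

(** Only one side of a double point differs from 1. *)
Lemma double_box_eq1 (d : nat) (P : pred 'I_d) (i j a : 'I_d) : P i -> P j -> i != j ->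
  exists2 l, P l & double_box a l = 1%N.
Proof.
move=> Pi Pj ij; have [ia|ia] := eqVneq i a.
  by exists j => //; rewrite /double_box -ia eq_sym (negPf ij).
by exists i => //; rewrite /double_box (negPf ia).
Qed.

Lemma odd_triple (d : nat) (i j l : 'I_d) : i != j -> i != l -> j != l ->
  odd #|[set i; j; l]%SET|.
Proof.
by move=> ij il jl; rewrite -finset.setUA cardsU1 cards2 !inE negb_or ij il jl.
Qed.

(** The complement of A = {0, 1, 2} must not be empty: only then does minus the
    indicator function of A have entries of both signs. *)
Theorem Z_odd_not_power (R : realType) (d n : nat) (E : lam_field d) : (3 < d)%N ->
  ps_one_plus (Z_odd R d) <> ps_pow (macmahon_neg (lam_field d) n) E.
Proof.
move=> d_gt3; have d_gt1 : (1 < d)%N by lia.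
have d_gt0 : (0 < d)%N by lia. have d_gt2 : (2 < d)%N by lia.
pose i0 := Ordinal d_gt0; pose i1 := Ordinal d_gt1.
pose i2 := Ordinal d_gt2; pose i3 := Ordinal d_gt3.
pose A := [set i0; i1; i2]%SET.
have i0A : i0 \in A by rewrite !inE.
have i1A : i1 \in A by rewrite !inE.
have AT : A != finset.setT.
  by apply/negP => /eqP/finset.setP/(_ i3); rewrite !inE.
have oddA : odd #|A| by apply: odd_triple.
pose rho : {rmorphism {mpoly rat[d]} -> lam_field d} := @FracField.tofrac {mpoly rat[d]}.
have rho0 f : rho f = 0 -> restrict_odd A i0 f = 0.
  by move=> /eqP; rewrite tofrac_eq0 => /eqP ->; rewrite rmorph0.
apply: (simple_pole_not_power rho0 (@mpolyC d rat : {rmorphism _ -> _})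
  (l := rho (linform (minus_indicator A)))).
- apply/vanishing_rho/(restrict_odd_eq0 i0A) => i; rewrite !ffunE i0A mulrN1.
  by [].
- rewrite /Z_odd fixed_points1 fsbig_set1.
  apply: (euler_box_pole _ d_gt1 i0A AT oddA (n := fun=> 1%N)) => //.
    by exists i0.
  exact: in_origin.
- rewrite /Z_odd fixed_points2 mulr_fsumr.
  apply: fsbig_closed => [|x y|_ [a _ <-]].
  + by rewrite -(rmorph0 rho); exact: regular_rho.
  + exact: regularD.
  apply/invertible_regular/(euler_box_pole _ d_gt1 i0A AT oddA (n := double_box a)) => //.
  + exact: double_box_eq1 i0A i1A _.
  + exact: in_double_point.
Qed.

(** Here the complement of A = {0, 1, 2} needs two elements, so that each double
    point has side 1 in some direction of the complement. *)
Theorem Z_cy_not_power (R : realType) (d n : nat) : (4 < d)%N -> ~~ odd d ->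
  exists l : weight d, forall (o : orientation d) (E : cy_field d),
    ps_one_plus (Z_cy R l o) <> ps_pow (macmahon_neg (cy_field d) n) E.
Proof.
move=> d_gt4 d_even; have d_gt1 : (1 < d)%N by lia.
have d_gt0 : (0 < d)%N by lia. have d_gt2 : (2 < d)%N by lia.
have d_gt3 : (3 < d)%N by lia.
pose i0 := Ordinal d_gt0; pose i1 := Ordinal d_gt1; pose i2 := Ordinal d_gt2.
pose i3 := Ordinal d_gt3; pose i4 := Ordinal d_gt4.
pose A := [set i0; i1; i2]%SET.
have i0A : i0 \in A by rewrite !inE.
have i1A : i1 \in A by rewrite !inE.
have i3A : i3 \notin A by rewrite !inE.
have i4A : i4 \notin A by rewrite !inE.
have oddA : odd #|A| by apply: odd_triple.
(* This weight is not constant on A, so its Chern class is a unit along the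
   hyperplane and does not cancel the pole of Z_1. *)
exists [ffun i => (i == i1)%:R] => o E; set l := [ffun i => _].
have rho0 := @rho_cy_restrict _ _ _ _ i0A i3A.
have l_inv : invertible (@rho_cy d) (restrict_even A i0 i3) (rho_cy d (linform l)).
  apply: invertible_rho; apply/eqP => /(restrict_even_eq0 i0A i3A)/(_ i1).
  by rewrite i1A !ffunE.
apply: (simple_pole_not_power rho0 (@mpolyC d rat : {rmorphism _ -> _})
  (l := rho_cy d (linform (minus_indicator A)))).
- apply/vanishing_rho/(restrict_even_eq0 i0A i3A) => i.
  by rewrite !ffunE i0A (negPf i3A); case: (i \in A).
- rewrite /Z_cy fixed_points1 fsbig_set1 taut_origin ?(invertible_neq0 rho0 l_inv) //.
  rewrite mulrA mulrCA; apply: invertibleM => //; apply: invertibleM.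
    by case: (o _); rewrite ?expr1 ?expr0; [apply: invertibleN|]; apply: invertible1.
  rewrite -[X in (-1) ^+ X](cardfs1 (0%MM : 'X_{1..d})).
  apply: (sqrt_cy_euler_box_pole _ i0A i3A oddA d_even (n := fun=> 1%N)) => //.
  + by exists i0.
  + by exists i3.
  + exact: in_origin.
- rewrite /Z_cy fixed_points2 mulr_fsumr.
  apply: fsbig_closed => [|x y|_ [a _ <-]].
  + by rewrite -(rmorph0 (rho_cy d)); exact: regular_rho.
  + exact: regularD.
  rewrite mulrA mulrCA; apply: regularM => //; last exact: regular_taut.
  apply/invertible_regular/invertibleM => //.
    by case: (o _); rewrite ?expr1 ?expr0; [apply: invertibleN|]; apply: invertible1.
  rewrite -[X in (-1) ^+ X](card_double_point a).
  apply: (sqrt_cy_euler_box_pole _ i0A i3A oddA d_even (n := double_box a)) => //.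
  + exact: double_box_eq1 i0A i1A _.
  + exact: (double_box_eq1 (P := [pred i | i \notin A]) _ i3A i4A).
  + exact: in_double_point.
Qed.

Theorem proposition1p1 (R : realType) :
  (forall d : nat, d = 5 \/ d = 7 ->
     forall E : lam_field d,
       ps_one_plus (Z_odd R d) <> ps_pow (macmahon_neg (lam_field d) d.-1) E)
  /\
  (forall d : nat, d = 8 \/ d = 12 ->
     exists l : weight d,
       forall (o : orientation d) (E : cy_field d),
         ps_one_plus (Z_cy R l o) <> ps_pow (macmahon_neg (cy_field d) d.-2) E).
Proof.
split=> d [] ->; by [move=> E; exact: Z_odd_not_power | exact: Z_cy_not_power].
Qed.
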